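(* Let $L>0$, let $K$ be a kernel satisfying the kernel conditions (K), let $h>0$ be the bandwidth, and let $q>0$, $M>0$. Let $\mu_1,\dots,\mu_n$ be i.i.d. random persistence measures on $\Omega$, with persistence intensity function $p$ and persistence density function $\tilde p$, satisfying: (i) (bounded total persistence) almost surely, $\max_{1\le i\le n}\int_\Omega\|\bm\omega-\partial\Omega\|_2^q\,\mathrm d\mu_i(\bm\omega)<M$; (ii) (boundedness) with $\bar p(\bm\omega):=\|\bm\omega-\partial\Omega\|_2^q\,p(\bm\omega)$, one has $\|\bar p\|_\infty<\infty$ and $\|\tilde p\|_\infty<\infty$. Then: (a) There exist positive constants $C_1,C_2$ depending on $M,\|K\|_\infty,\|K\|_2,\|\bar p\|_\infty$ and $q$ such that for any $\delta\in(0,1)$, with probability at least $1-\delta$, $$\sup_{\bm\omega\in\Omega_{2h}}\ell_{\bm\omega}^q\,|\hat p_h(\bm\omega)-\mathbb E\hat p_h(\bm\omega)|\le\max\left\{C_1\frac1{nh^2}\log\frac1{\delta h^2},\;C_2\sqrt{\frac1{nh^2}}\sqrt{\log\frac1{\delta h^2}}\right\},$$ where $\ell_{\bm\omega}:=\|\bm\omega-\partial\Omega\|_2-h$. (b) There exist positive constants $C_1,C_2$ depending on $M,\|K\|_\infty,\|K\|_2,\|\tilde p\|_\infty$ and $q$ such that for any $\delta\in(0,1)$, with probability at least $1-\delta$, $$\sup_{\bm\omega\in\Omega}|\check p_h(\bm\omega)-\mathbb E\check p_h(\bm\omega)|\le\max\left\{C_1\frac1{nh^2}\log\frac1{\delta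 h^2},\;C_2\sqrt{\frac1{nh^2}}\sqrt{\log\frac1{\delta h^2}}\right\}.$$
   Context: $\Omega=\{(b,d):0<b<d\le L\}\subset\mathbb R^2$, $\partial\Omega=\{(x,x):0\le x\le L\}$, $\|\bm\omega-\partial\Omega\|_2=\min_{\bm x\in\partial\Omega}\|\bm\omega-\bm x\|_2$, and $\Omega_\ell=\{\bm\omega\in\Omega:\|\bm\omega-\partial\Omega\|_2\ge\ell\}$. For $f$ on $\Omega$, $\|f\|_\infty=\sup_\Omega|f|$. A persistence measure is the counting measure $\mu=\sum_{i=1}^{N(D)}\delta_{\bm r_i}$ of a persistence diagram $D=\{\bm r_i\}$, a multiset of points of $\Omega$; its normalization is $\tilde\mu=\frac1{N(D)}\mu$. For a random persistence diagram, the persistence intensity function $p$ and the persistence density function $\tilde p$ are the Lebesgue densities on $\Omega$ (assumed to exist) of the measures $A\mapsto\mathbb E[\mu(A)]$ and $A\mapsto\mathbb E[\tilde\mu(A)]$. Kernel conditions (K) on $K:\mathbb R^2\to\mathbb R$: $K(\bm x)=0$ when $\|\bm x\|_2>1$; $\|K\|_\infty=\sup|K|<\infty$; $\int_{\mathbb R^2}K=1$; $\|K\|_2^2=\int_{\mathbb R^2}K^2<\infty$; there is a positive integer $s$ with $\int x_1^{s_1}x_2^{s_2}K(\bm x)\,\mathrm d\bm x=0$ for all non-negative integers $s_1,s_2$ with $1\le s_1+s_2<s$; $K$ is $L_K$-Lipschitz in the Euclidean norm. For bandwidth $h>0$, $K_h(\bm x)=h^{-2}K(\bm x/h)$, and the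 estimators are $$\hat p_h(\bm\omega)=\frac1n\sum_{i=1}^n\int_\Omega K_h(\bm x-\bm\omega)\,\mathrm d\mu_i(\bm x),\qquad \check p_h(\bm\omega)=\frac1n\sum_{i=1}^n\int_\Omega K_h(\bm x-\bm\omega)\,\mathrm d\tilde\mu_i(\bm x).$$
   Formalization: The bounds are proved for δh² ≤ r0 with an arbitrary r0 in (0,1), and the constants C1, C2 may also depend on r0 and on the Lipschitz constant L_K of the kernel; without this the claim fails as δh² → 1 and for rapidly oscillating kernels. *)

(* Defs.v *)
From HB Require Import structures.
From mathcomp Require Import all_boot all_order all_algebra.
From mathcomp Require Import finmap multiset.
From mathcomp Require Import all_classical all_reals all_analysis.
From mathcomp Require Import measurable_realfun.

Set Implicit Arguments.
Unset Strict Implicit.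
Unset Printing Implicit Defensive.

Import Order.TTheory GRing.Theory Num.Theory.
Import numFieldNormedType.Exports.

Local Open Scope classical_set_scope.
Local Open Scope ring_scope.

(* R^2 with its Borel sets. *)
Notation plane R := (measurableTypeR R * measurableTypeR R)%type.

Notation leb2 := (lebesgue_measure \x lebesgue_measure)%E.

Section Geometry.
Context {R : realType}.
Implicit Types (L l : R) (x w : plane R).

(* The library norm on a product is the max norm, hence this definition. *)
Definition enorm x : R := Num.sqrt ((x.1 : R) ^+ 2 + (x.2 : R) ^+ 2).

Definition psub x w : plane R := ((x.1 : R) - (w.1 : R), (x.2 : R) - (w.2 : R)).

Definition Omega L : set (plane R) :=
  [set w | [/\ 0 < (w.1 : R), (w.1 : R) < (w.2 : R) & (w.2 : R) <= L]].

Definition bdOmega L : set (plane R) := [set w | w.1 = w.2 /\ 0 <= (w.1 : R) <= L].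

Definition dist_bd L w : R := inf [set enorm (psub w x) | x in bdOmega L].

Definition Omega_from L l : set (plane R) :=
  [set w | Omega L w /\ l <= dist_bd L w].

(* Meaningful when [bounded_on A f]. *)
Definition supnorm (A : set (plane R)) (f : plane R -> R) : R :=
  sup [set `|f x| | x in A].

Definition bounded_on (A : set (plane R)) (f : plane R -> R) : Prop :=
  has_ubound [set `|f x| | x in A].

End Geometry.

Section Kernels.
Context {R : realType}.
Implicit Types (K : plane R -> R) (h : R) (x : plane R).

Definition L2norm K : R := Num.sqrt (\int[leb2]_x (K x ^+ 2)).

Record kernel_conditions K (LK : R) : Prop := {
  kernel_support : forall x, 1 < enorm x -> K x = 0;
  kernel_bounded : bounded_on setT K;
  kernel_mass : (\int[leb2]_x (K x)%:E = 1)%E;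
  kernel_L2 : (\int[leb2]_x (K x ^+ 2)%:E < +oo)%E;
  kernel_moments : exists s : nat, (0 < s)%N /\
    forall s1 s2 : nat, (1 <= s1 + s2 < s)%N ->
      (\int[leb2]_x ((x.1 : R) ^+ s1 * (x.2 : R) ^+ s2 * K x)%:E = 0)%E;
  kernel_lipschitz : forall x y, `|K x - K y| <= LK * enorm (psub x y)
}.

Definition scaled_kernel K h x : R :=
  h ^- 2 * K ((x.1 : R) / h, (x.2 : R) / h).

End Kernels.

Section Diagrams.
Context {R : realType}.

Definition diagram := multiset (plane R).

Implicit Types (L h : R) (D : diagram) (K : plane R -> R).

Definition pmeasure D : {measure set (plane R) -> \bar R} :=
  msum (fun i => dirac (nth ((0, 0) : plane R) (enum_mset D) i)
          : {measure set (plane R) -> \bar R})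
       (size (enum_mset D)).

(* The normalization of the empty diagram is the zero measure. *)
Definition npmeasure D : {measure set (plane R) -> \bar R} :=
  mscale ((size (enum_mset D))%:R^-1)%:nng (pmeasure D).

(* sigma-algebra on diagrams generated by the maps D |-> pmeasure D A;
   as usual for random measures, laws and independence refer to it *)
Definition diagram_events : set (set diagram) :=
  <<s [set S | exists (A : set (plane R)) (B : set (\bar R)), [/\ measurable A, measurable B &
                            S = (fun D : diagram => pmeasure D A) @^-1` B]] >>.

Definition estimator L K h (n : nat)
    (m : 'I_n -> {measure set (plane R) -> \bar R}) (w : plane R) : R :=
  n%:R^-1 *
  \sum_(i < n) \int[m i]_(x in Omega L) scaled_kernel K h (psub x w).

Definition phat L K h (n : nat) (D : 'I_n -> diagram) : plane R -> R :=
  estimator L K h (fun i => pmeasure (D i)).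

Definition pcheck L K h (n : nat) (D : 'I_n -> diagram) : plane R -> R :=
  estimator L K h (fun i => npmeasure (D i)).

End Diagrams.
Arguments diagram : clear implicits.

Section RandomDiagrams.
Context {R : realType} (d : measure_display) (T : measurableType d).
Implicit Types (P : probability T R) (L q M c : R) (p : plane R -> R).

(* p is a Lebesgue density on Omega of the mean measure A |-> E[m A] *)
Record mean_density P L (m : T -> {measure set (plane R) -> \bar R}) p : Prop := {
  mean_density_measurable : measurable_fun (Omega L) p;
  mean_density_ge0 : forall w, Omega L w -> 0 <= p w;
  mean_densityE : forall A, measurable A -> A `<=` Omega L ->
    (\int[P]_t (m t A) = \int[leb2]_(w in A) (p w)%:E)%E
}.

Record iid_diagrams P (n : nat) (D : 'I_n -> T -> diagram R) : Prop := {
  iid_measurable : forall i S, diagram_events S -> measurable (D i @^-1` S);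
  iid_identical : forall i j S, diagram_events S ->
    P (D i @^-1` S) = P (D j @^-1` S);
  iid_independent : forall S : 'I_n -> set (diagram R),
    (forall i, diagram_events (S i)) ->
    P (\bigcap_(i in [set: 'I_n]) (D i @^-1` S i)) =
    (\prod_(i < n) P (D i @^-1` S i))%E
}.

Record persistence_sample P L (n : nat) (D : 'I_n -> T -> diagram R) p pt : Prop := {
  sample_size : (0 < n)%N;
  sample_in_Omega : forall i t r, r \in enum_mset (D i t) -> Omega L r;
  sample_iid : iid_diagrams P D;
  sample_intensity : forall i, mean_density P L (fun t => pmeasure (D i t)) p;
  sample_density : forall i, mean_density P L (fun t => npmeasure (D i t)) pt
}.

Definition bounded_total_persistence P L q M (n : nat)
    (D : 'I_n -> T -> diagram R) : Prop :=
  {ae P, forall t, (\big[maxe/-oo]_(i < n)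
     \int[pmeasure (D i t)]_(w in Omega L) (dist_bd L w `^ q)%:E < M%:E)%E}.

Definition weighted L q p : plane R -> R := fun w => dist_bd L w `^ q * p w.

(* "E holds with probability at least c", without presupposing that E is
   measurable; for measurable E this is c <= P E *)
Definition probability_ge P c (E : set T) : Prop :=
  exists A, [/\ measurable A, A `<=` E & (c%:E <= P A)%E].

End RandomDiagrams.

(* Only meaningful for delta * h ^+ 2 < 1: otherwise the logarithm is
   nonpositive and its square root is 0. *)
Definition deviation_bound {R : realType} (C1 C2 : R) (n : nat) (h delta : R) : R :=
  Num.max
    (C1 * (n%:R * h ^+ 2)^-1 * ln ((delta * h ^+ 2)^-1))
    (C2 * Num.sqrt ((n%:R * h ^+ 2)^-1) * Num.sqrt (ln ((delta * h ^+ 2)^-1))).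

(* Main.v *)
Require Import Defs.
From HB Require Import structures.
From mathcomp Require Import all_boot all_order all_algebra.
From mathcomp Require Import finmap multiset zify ring lra.
From mathcomp Require Import all_classical all_reals all_analysis.
From mathcomp Require Import measurable_realfun.

Set Implicit Arguments.
Unset Strict Implicit.
Unset Printing Implicit Defensive.

Import Order.TTheory GRing.Theory Num.Theory.
Import numFieldNormedType.Exports.

Local Open Scope classical_set_scope.
Local Open Scope ring_scope.

(* The triangle is cut into squares of side h. In each square the kernel sums
   Y(w), w in the square, are Lipschitz in w (K is Lipschitz), with a constant
   proportional to the mass X that the diagram puts near the square, so that
   dyadic chaining applies: an increment f with |f| <= a X, X <= 1, E X = m
   satisfies E exp(l (f - E f)) <= exp(2 (l a)^2 m) when l a <= 1, and the
   increments of level k have a = O(2^-k), which makes the sum of the Bernstein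
   thresholds over the levels comparable to its first term.

   The constants do not depend on L although the number of squares does: since
   exp is convex, exp(s m) - 1 <= (m / mb) (exp(s mb) - 1) for m <= mb, so the
   deviation probability of a square is proportional to its mean mass. The mean
   masses sum to at most 16 and each is at most mb = rho h^2 (bounded density),
   so the effective number of squares is 1 / h^2, which is the h^2 in
   log (1 / (delta h^2)).

   For the intensity the diagrams have no bounded mass, but dist^q does; on a
   square the weight (dist - h)^q is comparable to a constant, which is at most
   dist^q at the points seen by the kernel; so (a) reduces to the same bound. *)

(** * Expectation of a product of independent variables *)

Section Independence.
Context {R : realType} (d d' : measure_display) (T : measurableType d)
  (E : measurableType d') (P : probability T R).
Import HBNNSimple.

(** The identity assumed for indicators extends to simple functions by linearity, and to [F] by
    monotone convergence along the approximations [f n]. In its use below, [c] is the product of the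
    means of the other factors. *)
Lemma integral_indep_step (D : T -> E) (G : T -> R) (c : R) (F : E -> R) :
  measurable_fun setT D -> measurable_fun setT G -> (forall t, 0 <= G t) ->
  0 <= c ->
  (forall S, measurable S ->
     (\int[P]_t (G t * \1_S (D t))%:E = c%:E * \int[P]_t (\1_S (D t))%:E)%E) ->
  measurable_fun setT F -> (forall x, 0 <= F x) ->
  (\int[P]_t (G t * F (D t))%:E = c%:E * \int[P]_t (F (D t))%:E)%E.
Proof.
move=> mD mG G0 c0 H mF F0.
have mF' : measurable_fun setT (EFin \o F) by exact/measurable_EFinP.
pose f := nnsfun_approx measurableT mF'.
have fE x : (f n x)%:E @[n --> \oo] --> (F x)%:E.
  by apply: (cvg_nnsfun_approx measurableT mF') => // y _; rewrite lee_fin.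
have mfD n : measurable_fun setT (fun t => f n (D t)).
  exact: (measurableT_comp (measurable_funPT (f n)) mD).
have key n : (\int[P]_t (G t * f n (D t))%:E = c%:E * \int[P]_t (f n (D t))%:E)%E.
  transitivity (\int[P]_t (\sum_(r \in range (f n))
      (r * (G t * \1_(f n @^-1` [set r]) (D t)))%:E))%E.
    apply: eq_integral => t _; rewrite fimfunE fsumEFin// mulr_fsumr//.
    by congr EFin; apply: eq_fsbigr => r _; rewrite mulrCA.
  have mG1 r : measurable_fun setT (fun t => G t * \1_(f n @^-1` [set r]) (D t)).
    by apply: measurable_funM => //; apply: measurableT_comp.
  have mr r : measurable_fun setT (fun t => (\1_(f n @^-1` [set r]) (D t)) : R).
    by apply: measurableT_comp.
  rewrite ge0_integral_fsum//; last 2 first.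
  - by move=> r; apply/measurable_EFinP; apply: measurable_funM.
  - move=> r t _; rewrite lee_fin mulrCA mulr_ge0//.
    by have := @nnfun_muleindic_ge0 _ _ _ (f n) r (D t); rewrite -EFinM lee_fin.
  transitivity (\sum_(r \in range (f n)) (c%:E * (r%:E *
      \int[P]_t (\1_(f n @^-1` [set r]) (D t))%:E)))%E.
    apply: eq_fsbigr => r; rewrite inE => -[x _ <-].
    under eq_integral do rewrite EFinM.
    rewrite ge0_integralZl//.
    + by rewrite H// muleCA.
    + exact/measurable_EFinP.
    + by move=> t _; rewrite lee_fin mulr_ge0.
    + by rewrite lee_fin.
  rewrite -ge0_mule_fsumr//; last first.
    (* A negative [r] is not a value of [f n], so its indicator vanishes and every summand is
       nonnegative. *)
    move=> r; have [r0|r0] := leP 0 r.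
      by rewrite mule_ge0// ?lee_fin//; apply: integral_ge0 => t _; rewrite lee_fin.
    rewrite integral0_eq ?mule0// => t _.
    by rewrite preimage_nnfun0// indicE in_set0.
  congr (_ * _)%E.
  transitivity (\int[P]_t (\sum_(r \in range (f n))
      (r * \1_(f n @^-1` [set r]) (D t))%:E))%E; last first.
    by apply: eq_integral => t _; rewrite [in RHS]fimfunE fsumEFin.
  rewrite ge0_integral_fsum//; last 2 first.
  - by move=> r; apply/measurable_EFinP; apply: measurable_funM.
  - move=> r t _.
    by have := @nnfun_muleindic_ge0 _ _ _ (f n) r (D t); rewrite -EFinM.
  apply: eq_fsbigr => r; rewrite inE => -[x _ <-].
  under [RHS]eq_integral do rewrite EFinM.
  rewrite ge0_integralZl//; first exact/measurable_EFinP.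
  by rewrite lee_fin.
have nd t m n : (m <= n)%N -> f m t <= f n t.
  by move=> mn; have /lefP := nd_nnsfun_approx measurableT mF' mn; apply.
transitivity (\int[P]_t (limn (fun n => (G t * f n (D t))%:E)))%E.
  apply: eq_integral => t _; apply/esym/cvg_lim => //.
  under eq_fun do rewrite EFinM.
  by rewrite EFinM; apply: cvgeZl => //.
rewrite (monotone_convergence P measurableT); last 3 first.
- by move=> n; apply/measurable_EFinP; apply: measurable_funM.
- by move=> n t _; rewrite lee_fin mulr_ge0.
- by move=> t _ m n mn; rewrite lee_fin ler_wpM2l// nd.
transitivity (c%:E * \int[P]_t (limn (fun n => (f n (D t))%:E)))%E; last first.
  by congr (_ * _)%E; apply: eq_integral => t _; apply/cvg_lim.
rewrite (monotone_convergence P measurableT); last 3 first.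
- by move=> n; apply/measurable_EFinP.
- by move=> n t _; rewrite lee_fin.
- by move=> t _ m n mn; rewrite lee_fin nd.
under eq_fun do rewrite key.
apply/cvg_lim => //; apply: cvgeZl => //.
apply: ereal_nondecreasing_is_cvgn => m n mn; apply: ge0_le_integral => //.
- by move=> t _; rewrite lee_fin.
- exact/measurable_EFinP.
- exact/measurable_EFinP.
- by move=> t _; rewrite lee_fin nd.
Qed.

Lemma expectation_prod_indep (n : nat) (D : 'I_n -> T -> E) (F : 'I_n -> E -> R) :
  (forall i, measurable_fun setT (D i)) ->
  (forall S : 'I_n -> set E, (forall i, measurable (S i)) ->
    P (\bigcap_(i in [set: 'I_n]) (D i @^-1` S i)) =
    (\prod_(i < n) P (D i @^-1` S i))%E) ->
  (forall i, measurable_fun setT (F i)) -> (forall i x, 0 <= F i x) ->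
  (forall i, (\int[P]_t (F i (D i t))%:E < +oo)%E) ->
  (\int[P]_t (\prod_(i < n) F i (D i t))%:E =
   \prod_(i < n) \int[P]_t (F i (D i t))%:E)%E.
Proof.
move=> mD ind mF F0 Ffin.
(* Induction on the number [k] of leading factors that may be arbitrary, the others being
   indicators; for [k = 0] the claim is the independence hypothesis. *)
suff gen (k : nat) (Phi : 'I_n -> E -> R) :
    (forall i, measurable_fun setT (Phi i)) -> (forall i x, 0 <= Phi i x) ->
    (forall i, (\int[P]_t (Phi i (D i t))%:E < +oo)%E) ->
    (forall i : 'I_n, (k <= i)%N -> exists2 S, measurable S & Phi i = \1_S) ->
    (\int[P]_t (\prod_(i < n) Phi i (D i t))%:E =
     \prod_(i < n) \int[P]_t (Phi i (D i t))%:E)%E.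
  by apply: (gen n) => // i; rewrite leqNgt ltn_ord.
elim: k Phi => [|k IH] Phi mPhi Phi0 Phifin Phiind.
  have /choice[S HS] : forall i, exists S, measurable S /\ Phi i = \1_S.
    by move=> i; have [S mS ->] := Phiind i (leq0n _); exists S.
  have mS i : measurable (D i @^-1` S i).
    by rewrite -[X in measurable X]setTI; apply: mD => //; have [] := HS i.
  transitivity (\int[P]_t (\1_(\bigcap_(i in [set: 'I_n]) (D i @^-1` S i)) t)%:E)%E.
    apply: eq_integral => t _; congr EFin; rewrite indicE.
    have [/set_mem h|/negP h] := boolP (t \in _).
      rewrite big1// => i _; have [_ ->] := HS i.
      by rewrite indicE mem_set//; exact: h.
    have [i hi] : exists i, ~ S i (D i t).
      by apply/existsNP => h'; apply: h; apply/mem_set => i _; exact: h'.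
    rewrite (bigD1 i)//=; have [_ ->] := HS i.
    by rewrite indicE memNset ?mul0r.
  rewrite integral_indic//; last first.
    by apply: fin_bigcap_measurable => // ; exact: finite_finset.
  rewrite setIT; etransitivity; first by apply: (ind S) => i; have [] := HS i.
  apply: eq_bigr => i _; rewrite -[in LHS](setIT (D i @^-1` S i)) -integral_indic//.
  by apply: eq_integral => t _; have [_ ->] := HS i.
have [kn|nk] := ltnP k n; last first.
  by apply: IH => // i ki; apply: Phiind; case: i ki => /= i hi ki; move: (leq_ltn_trans ki hi); rewrite ltnNge nk.
pose k' := Ordinal kn.
have G0 t : 0 <= \prod_(i < n | i != k') Phi i (D i t) by apply: prodr_ge0.
have mPD i : measurable_fun setT (fun t => Phi i (D i t)) by apply: measurableT_comp.
have Efin i : (\int[P]_t (Phi i (D i t))%:E)%E \is a fin_num.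
  by rewrite ge0_fin_numE//; apply: integral_ge0 => t _; rewrite lee_fin.
pose e i := fine (\int[P]_t (Phi i (D i t))%:E)%E.
have eE i : (\int[P]_t (Phi i (D i t))%:E)%E = (e i)%:E by rewrite fineK.
rewrite [RHS](eq_bigr (fun i => (e i)%:E)); last by move=> i _; exact: eE.
rewrite prodEFin (bigD1 k')//= EFinM muleC -eE.
rewrite -(@integral_indep_step (D k') (fun t => \prod_(i < n | i != k') Phi i (D i t))
  (\prod_(i < n | i != k') e i) (Phi k')) //.
- apply: eq_integral => t _; congr EFin.
  by rewrite (bigD1 k')//= mulrC.
- by under eq_fun do rewrite -big_filter; apply: measurable_prod.
- by apply: prodr_ge0 => i _; rewrite fine_ge0// integral_ge0// => t _; rewrite lee_fin.
move=> S mS.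
(* With factor [k'] replaced by an indicator, the induction hypothesis applies and supplies the
   identity on indicators. *)
pose Psi i := if i == k' then \1_S else Phi i.
have Psifin i : (\int[P]_t (Psi i (D i t))%:E < +oo)%E.
  rewrite /Psi; case: eqP => [->|//]; rewrite integral_indic//.
    by rewrite setIT (le_lt_trans (probability_le1 _ _))// ?ltry// -[X in measurable X]setTI; exact: mD.
  by rewrite -[X in measurable X]setTI; exact: mD.
have mPsi i : measurable_fun setT (Psi i) by rewrite /Psi; case: ifP.
have Psi0 i x : 0 <= Psi i x by rewrite /Psi; case: ifP.
have Psiind (i : 'I_n) : (k <= i)%N -> exists2 S, measurable S & Psi i = \1_S.
  rewrite /Psi leq_eqVlt => /orP[/eqP ki|ki]; last first.
    by case: eqP => [_|_]; [exists S|exact: Phiind].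
  by rewrite -(_ : k' = i) ?eqxx; [exists S|exact/val_inj].
transitivity (\int[P]_t (\prod_(i < n) Psi i (D i t))%:E)%E.
  apply: eq_integral => t _; congr EFin.
  rewrite [RHS](bigD1 k')//= {1}/Psi eqxx mulrC; congr (_ * _).
  by apply: eq_bigr => i ik; rewrite /Psi (negbTE ik).
rewrite (IH Psi)// [LHS](bigD1 k')//= {1}/Psi eqxx muleC; congr (_ * _)%E.
rewrite -prodEFin; apply: eq_bigr => i ik.
by rewrite -eE /Psi (negbTE ik).
Qed.
End Independence.

(** * Exponential moments *)

Section RealInequalities.
Context {R : realType}.
Implicit Types x y z : R.

(** Since [(1 - y / 2) ^+ 2 <= expR (- y)], it suffices that [(1 + y + 2 * y ^+ 2) * (1 - y / 2) ^+
    2 >= 1]; the difference of the two sides is [y ^+ 2 * (1 - y) * (5 - 2 * y) / 4]. *)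
Lemma expR_le_quadratic y : y <= 1 -> expR y <= 1 + y + 2 * y ^+ 2.
Proof.
move=> y1; have h := expR_ge1Dx (- y / 2).
have p : 0 < 1 + - y / 2 by lra.
have sq : (1 + - y / 2) ^+ 2 <= expR (- y).
  rewrite [X in _ <= expR X](_ : _ = - y / 2 + - y / 2); last by lra.
  by rewrite expRD -expr2 ler_sqr// ?nnegrE ?expR_ge0// ltW.
have e1 : expR y * expR (- y) = 1 by rewrite -expRD subrr expR0.
have q : 0 <= 1 + y + 2 * y ^+ 2 by nra.
have : 1 <= (1 + y + 2 * y ^+ 2) * expR (- y).
  apply: le_trans (ler_wpM2l q sq).
  have : 0 <= y ^+ 2 * ((1 - y) * (5 - 2 * y)).
    by rewrite mulr_ge0 ?sqr_ge0// mulr_ge0; lra.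
  by nra.
rewrite -e1 ler_pM2r// expR_gt0//.
Qed.

(* The bound is linear in [m]: summed over cells of small mass it replaces a
   count of the cells. *)
Lemma expR_convex_le (s m mb : R) : 0 < mb -> 0 <= m -> m <= mb ->
  expR (s * m) - 1 <= m / mb * (expR (s * mb) - 1).
Proof.
move=> mb0 m0 mmb; set l := m / mb; set z := s * mb.
have l0 : 0 <= l by rewrite divr_ge0// ltW.
have l1 : l <= 1 by rewrite ler_pdivrMr// mul1r.
have -> : s * m = l * z by rewrite /l /z mulrCA mulfVK ?gt_eqF// mulrC.
(* [h1] and [h2] compare [expR] at [z] and at [0] with its tangent at [l * z]; with the weights [l]
   and [1 - l] the linear terms cancel. *)
have h1 : expR (l * z) * (1 + (1 - l) * z) <= expR z.
  rewrite [leRHS](_ : _ = expR (l * z) * expR ((1 - l) * z)).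
    by rewrite ler_pM2l ?expR_gt0// expR_ge1Dx.
  by rewrite -expRD; congr expR; ring.
have h2 : expR (l * z) * (1 - l * z) <= 1.
  rewrite -[leRHS](_ : expR (l * z) * expR (- (l * z)) = 1).
    by rewrite ler_pM2l ?expR_gt0// expR_ge1Dx.
  by rewrite -expRD subrr expR0.
have := ler_wpM2l l0 h1.
have l1' : 0 <= 1 - l by rewrite subr_ge0.
have := ler_wpM2l l1' h2.
lra.
Qed.

(** This is [2 * (cosh x - 1)]: one nonnegative function for both tails. It vanishes at 0, so that
    its mean can be bounded proportionally to the mass of a cell. *)
Definition cosh2 x := expR x + expR (- x) - 2.

Lemma cosh2_ge0 x : 0 <= cosh2 x.
Proof.
have := expR_ge1Dx x; have := expR_ge1Dx (- x); rewrite /cosh2; lra.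
Qed.

(** From [y >= 3] follows [expR y >= 4], so subtracting 2 costs at most half of [expR y]. *)
Lemma cosh2_tail x y : 3 <= y -> y <= `|x| -> expR y / 2 <= cosh2 x.
Proof.
move=> y3 yx.
have e4 : 4 <= expR y by apply: le_trans (expR_ge1Dx y); lra.
have: expR y <= expR `|x| by rewrite ler_expR.
rewrite /cosh2; have := expR_gt0 x; have := expR_gt0 (- x).
by case: (ger0P x) => _; lra.
Qed.

Lemma sum_dyadic_le4 (K : nat) : \sum_(k < K) 2^-1 ^+ k * (k.+1)%:R <= 4 :> R.
Proof.
suff -> : \sum_(k < K) 2^-1 ^+ k * (k.+1)%:R = 4 - 2^-1 ^+ K * (2 * K%:R + 4) :> R.
  by rewrite lerBlDr lerDl mulr_ge0// ?exprn_ge0// addr_ge0// mulr_ge0.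
elim: K => [|K IH]; first by rewrite big_ord0 expr0; ring.
rewrite big_ord_recr/= IH exprSr -(natr1 K).
have : 2 * 2^-1 = 1 :> R by rewrite mulfV.
set a := 2^-1 ^+ K; set b := 2^-1; nra.
Qed.

End RealInequalities.

Lemma integral_prob_cst {R : realType} d (T : measurableType d)
  (P : probability T R) (c : R) : (\int[P]_t c%:E = c%:E)%E.
Proof.
by rewrite integral_cst// -[RHS]mule1; congr (_ * _)%E; exact: probability_setT.
Qed.

(** * Exponential moments of centered sums dominated by an envelope *)

Section ExponentialMoment.
Context {R : realType} (d d' : measure_display) (T : measurableType d)
  (E : measurableType d') (P : probability T R) (n : nat) (D : 'I_n -> T -> E).

Definition mean (i : 'I_n) (f : E -> R) : R := fine (\int[P]_t (f (D i t))%:E).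

Definition centered_sum (f : E -> R) (t : T) : R :=
  \sum_(i < n) (f (D i t) - mean i f).

Hypothesis mD : forall i, measurable_fun setT (D i).
Hypothesis ind : forall S : 'I_n -> set E, (forall i, measurable (S i)) ->
    P (\bigcap_(i in [set: 'I_n]) (D i @^-1` S i)) =
    (\prod_(i < n) P (D i @^-1` S i))%E.

Variables (X : E -> R) (m : R).
Hypothesis mX : measurable_fun setT X.
Hypothesis X0 : forall e, 0 <= X e.
Hypothesis Xm : forall i, (\int[P]_t (X (D i t))%:E = m%:E)%E.

Lemma integrable_dominated a (f : E -> R) i : measurable_fun setT f ->
  (forall e, `|f e| <= a * X e) -> P.-integrable setT (fun t => (f (D i t))%:E).
Proof.
(* The sign of [a] is not assumed, hence the majorant with [|a|]. *)
move=> mf fX; apply: (@le_integrable _ _ _ _ _ measurableT _ (fun t => (`|a| * X (D i t))%:E)).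
- by apply/measurable_EFinP; apply: measurableT_comp.
- move=> t _; rewrite lee_fin; apply: le_trans (fX _) _.
  by rewrite ger0_norm ?mulr_ge0// ler_wpM2r// ler_norm.
- under eq_fun do rewrite EFinM.
  apply: integrableZl => //; apply/integrableP; split.
    by apply/measurable_EFinP; apply: measurableT_comp.
  under eq_integral do rewrite gee0_abs ?lee_fin//.
  by rewrite Xm ltry.
Qed.

Lemma meanE a (f : E -> R) i : measurable_fun setT f ->
  (forall e, `|f e| <= a * X e) -> (\int[P]_t (f (D i t))%:E = (mean i f)%:E)%E.
Proof.
by move=> mf fX; rewrite fineK//; apply: integrable_fin_num => //; exact: integrable_dominated fX.
Qed.

Lemma meanB a a' (f g : E -> R) i : measurable_fun setT f -> measurable_fun setT g ->
  (forall e, `|f e| <= a * X e) -> (forall e, `|g e| <= a' * X e) ->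
  mean i (fun e => f e - g e) = mean i f - mean i g.
Proof.
move=> mf mg fX gX; rewrite [LHS]/mean.
under eq_integral do rewrite EFinB.
rewrite integralB//; [|exact: integrable_dominated fX|exact: integrable_dominated gX].
by rewrite (meanE _ mf fX) (meanE _ mg gX).
Qed.

Lemma centered_sumB a a' (f g : E -> R) t : measurable_fun setT f -> measurable_fun setT g ->
  (forall e, `|f e| <= a * X e) -> (forall e, `|g e| <= a' * X e) ->
  centered_sum (fun e => f e - g e) t = centered_sum f t - centered_sum g t.
Proof.
move=> mf mg fX gX; rewrite /centered_sum -sumrB; apply: eq_bigr => i _.
by rewrite (meanB i mf mg fX gX); ring.
Qed.

Lemma measurable_centered_sum f : measurable_fun setT f ->
  measurable_fun setT (centered_sum f).
Proof.
move=> mf; apply: measurable_sum => i; apply: measurable_funB => //.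
exact: measurableT_comp.
Qed.

Hypothesis X1 : forall i, {ae P, forall t, X (D i t) <= 1}.

Lemma mean_bound_ge0 : (0 < n)%N -> 0 <= m.
Proof.
move=> n0; rewrite -lee_fin -(Xm (Ordinal n0)).
by apply: integral_ge0 => t _; rewrite lee_fin.
Qed.

(** As [l * f <= th * X <= 1], the quadratic bound on [expR] applies, and [X ^+ 2 <= X] turns its
    last term into [2 * th ^+ 2 * X], of mean linear in [m]. Then [1 + z <= expR z], and centering
    removes the linear term. *)
Lemma expR_moment_le a (f : E -> R) l th i : measurable_fun setT f ->
  (forall e, `|f e| <= a * X e) -> `|l| * a <= th -> 0 <= th -> th <= 1 ->
  (\int[P]_t (expR (l * (f (D i t) - mean i f)))%:E <= (expR (2 * th ^+ 2 * m))%:E)%E.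
Proof.
move=> mf fX la th0 th1.
have lf e : `|l * f e| <= th * X e.
  rewrite normrM; apply: le_trans (ler_wpM2l (normr_ge0 _) (fX e)) _.
  by rewrite mulrA ler_wpM2r.
set g := fun e => 1 + l * f e + 2 * th ^+ 2 * X e.
have mg : measurable_fun setT g.
  by apply: measurable_funD; [apply: measurable_funD => //|]; exact: measurable_funM.
have pt e : X e <= 1 -> expR (l * f e) <= g e.
  move=> Xe; have := lf e; rewrite ler_norml => /andP[h1 h2].
  have h3 : th * X e <= 1 by rewrite -[1]mulr1 ler_pM.
  apply: le_trans (expR_le_quadratic _) _; first exact: le_trans h3.
  rewrite lerD2l -mulrA ler_wpM2l//.
  have : (l * f e) ^+ 2 <= (th * X e) ^+ 2.
    by rewrite -[leLHS]real_normK ?num_real// ler_sqr ?nnegrE// mulr_ge0.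
  move/le_trans; apply; rewrite exprMn ler_wpM2l ?sqr_ge0//.
  by rewrite expr2 ler_piMl.
have mfi : measurable_fun setT (fun t => f (D i t)) by exact: measurableT_comp.
have mXi : measurable_fun setT (fun t => X (D i t)) by exact: measurableT_comp.
have If : P.-integrable setT (fun t => (f (D i t))%:E) by exact: integrable_dominated fX.
have IX : P.-integrable setT (fun t => (X (D i t))%:E).
  by apply: (@integrable_dominated 1) => // e; rewrite mul1r ger0_norm.
have I1 : P.-integrable setT (fun t => (1 : R)%:E).
  exact: finite_measure_integrable_cst.
have intg : (\int[P]_t (g (D i t))%:E = (1 + l * mean i f + 2 * th ^+ 2 * m)%:E)%E.
  rewrite /g; under eq_integral do rewrite !EFinD !(EFinM l) (EFinM (2 * th ^+ 2)).
  have IlF : P.-integrable setT (fun t => l%:E * (f (D i t))%:E)%E by exact: integrableZl.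
  have IlX : P.-integrable setT (fun t => (2 * th ^+ 2)%:E * (X (D i t))%:E)%E by exact: integrableZl.
  rewrite integralD//; last exact: integrableD.
  rewrite integralD// !integralZl// Xm (meanE _ mf fX).
  by rewrite integral_prob_cst -!EFinM -!EFinD.
(* The maximum with 0 makes the integrand nonnegative everywhere, so that the almost sure bound [pt]
   can be integrated; almost surely it changes nothing. *)
apply: (@le_trans _ _ ((expR (- (l * mean i f)))%:E * \int[P]_t (Num.max 0 (g (D i t)))%:E)%E).
  rewrite -ge0_integralZl//; last 2 first.
  - by apply/measurable_EFinP; apply: measurable_maxr => //; exact: measurableT_comp.
  - by move=> t _; rewrite lee_fin le_max lexx.
  apply: ae_ge0_le_integral => //.
  - apply/measurable_EFinP; apply: measurableT_comp => //.
    by apply: measurable_funM => //; apply: measurable_funB.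
  - by move=> t _; rewrite -EFinM lee_fin mulr_ge0 ?expR_ge0// le_max lexx.
  - under eq_fun do rewrite -EFinM.
    apply/measurable_EFinP; apply: measurable_funM => //.
    by apply: measurable_maxr => //; exact: measurableT_comp.
  apply: filterS (X1 i) => t Xt _; rewrite -EFinM lee_fin.
  rewrite mulrBr addrC expRD ler_wpM2l ?expR_ge0//.
  by rewrite le_max pt// orbT.
have -> : (\int[P]_t (Num.max 0 (g (D i t)))%:E = \int[P]_t (g (D i t))%:E)%E.
  apply: ae_eq_integral => //.
  - by apply/measurable_EFinP; apply: measurable_maxr => //; exact: measurableT_comp.
  - by apply/measurable_EFinP; exact: measurableT_comp.
  apply: filterS (X1 i) => t Xt _; congr EFin; apply/max_idPr.
  exact: le_trans (expR_ge0 _) (pt _ Xt).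
rewrite intg -EFinM lee_fin mulrC -ler_pdivlMr ?expR_gt0// -expRN opprK -expRD.
by apply: le_trans (expR_ge1Dx _); lra.
Qed.

Lemma expR_centered_sum_le a (f : E -> R) l th : measurable_fun setT f ->
  (forall e, `|f e| <= a * X e) -> `|l| * a <= th -> 0 <= th -> th <= 1 ->
  (\int[P]_t (expR (l * centered_sum f t))%:E <= (expR (2 * n%:R * th ^+ 2 * m))%:E)%E.
Proof.
move=> mf fX la th0 th1.
have L := fun i => expR_moment_le i mf fX la th0 th1.
under eq_integral do rewrite /centered_sum mulr_sumr expR_sum.
rewrite (@expectation_prod_indep _ _ _ _ _ _ _ D
  (fun i e => expR (l * (f e - mean i f))))//; last 2 first.
- move=> i; apply: measurableT_comp => //.
  by apply: measurable_funM => //; apply: measurable_funB.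
- by move=> i; apply: le_lt_trans (L i) _; rewrite ltry.
pose c i := fine (\int[P]_t (expR (l * (f (D i t) - mean i f)))%:E)%E.
have I0 i : (0 <= \int[P]_t (expR (l * (f (D i t) - mean i f)))%:E)%E.
  by apply: integral_ge0 => t _; rewrite lee_fin expR_ge0.
have cE i : (\int[P]_t (expR (l * (f (D i t) - mean i f)))%:E = (c i)%:E)%E.
  by rewrite fineK// ge0_fin_numE// (le_lt_trans (L i))// ltry.
rewrite (eq_bigr (fun i => (c i)%:E)) => [|i _]; last exact: cE.
rewrite prodEFin lee_fin.
apply: (@le_trans _ _ (\prod_(i < n) expR (2 * th ^+ 2 * m))).
  by apply: ler_prod => i _; rewrite fine_ge0//= -lee_fin -cE.
by rewrite -expR_sum sumr_const card_ord ler_expR -mulr_natl; lra.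
Qed.

(** Adding the bounds for [l] and [- l] and subtracting 2 leaves [2 * (expR (s * m) - 1)] with
    [s = 2 * n%:R * th ^+ 2], which [expR_convex_le] makes proportional to [m]. *)
Lemma cosh2_centered_sum_le a (f : E -> R) l th mb : measurable_fun setT f ->
  (forall e, `|f e| <= a * X e) -> `|l| * a <= th -> 0 <= th -> th <= 1 ->
  (0 < n)%N -> 0 < mb -> m <= mb ->
  (\int[P]_t (cosh2 (l * centered_sum f t))%:E <=
    (2 * (m / mb) * expR (2 * n%:R * th ^+ 2 * mb))%:E)%E.
Proof.
move=> mf fX la th0 th1 n0 mb0 mmb.
have mS := measurable_centered_sum mf.
have M l' : measurable_fun setT (fun t => (expR (l' * centered_sum f t))%:E).
  by apply/measurable_EFinP; apply: measurableT_comp => //; apply: measurable_funM.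
have L : (\int[P]_t (cosh2 (l * centered_sum f t))%:E + 2%:E <=
   (expR (2 * n%:R * th ^+ 2 * m))%:E + (expR (2 * n%:R * th ^+ 2 * m))%:E)%E.
  apply: (@le_trans _ _ (\int[P]_t (expR (l * centered_sum f t))%:E +
     \int[P]_t (expR (- l * centered_sum f t))%:E)%E); last first.
    by apply: leeD; apply: (expR_centered_sum_le mf fX _ th0 th1); rewrite ?normrN.
  rewrite -ge0_integralD//.
  rewrite -[X in (_ + X)%E](_ : \int[P]_t (2:R)%:E = 2%:E)%E; last first.
    exact: integral_prob_cst.
  rewrite -ge0_integralD//; last 2 first.
  - by move=> t _; rewrite lee_fin cosh2_ge0.
  - apply/measurable_EFinP; apply: measurable_funB => //; apply: measurable_funD;
      apply: measurableT_comp => //; last apply: measurableT_comp => //;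
      exact: measurable_funM.
  rewrite le_eqVlt; apply/orP; left; apply/eqP.
  by apply: eq_integral => t _; rewrite -!EFinD /cosh2 mulNr; congr EFin; ring.
have := L; rewrite -EFinD -leeBrDr//; move/le_trans; apply.
rewrite -EFinB lee_fin.
have := @expR_convex_le R (2 * n%:R * th ^+ 2) m mb mb0 (mean_bound_ge0 n0) mmb.
have := divr_ge0 (mean_bound_ge0 n0) (ltW mb0).
nra.
Qed.

End ExponentialMoment.

(** * Chaining *)

Section DyadicGrid.
Context {R : realType}.

Definition grid (i k : nat) : R := i%:R * 2^-1 ^+ k.

(** Halving the index drops the last binary digit, [odd i]. *)
Lemma grid_half (i k : nat) : `|grid i k.+1 - grid i./2 k| <= 2^-1 ^+ k.+1.
Proof.
rewrite /grid.
have -> : i%:R * 2^-1 ^+ k.+1 - (i./2)%:R * 2^-1 ^+ k = (odd i)%:R * 2^-1 ^+ k.+1 :> R.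
  rewrite -[in i%:R](odd_double_half i) natrD -mul2n natrM exprS.
  by have : 2 * 2^-1 = 1 :> R by [rewrite mulfV]; set a := 2^-1 ^+ k; set b := 2^-1; nra.
rewrite ger0_norm ?mulr_ge0 ?exprn_ge0//.
by case: (odd i); rewrite ?mul1r// mul0r exprn_ge0.
Qed.

(** The index [i k] is the integer part of [u * 2 ^+ k]: the binary expansion of [u] cut after [k]
    digits, whence the halving relation between levels. *)
Lemma grid_approx (u : R) : 0 <= u -> u < 1 -> exists i : nat -> nat,
  [/\ forall k, (i k < 2 ^ k)%N, forall k, ((i k.+1)./2 = i k)%N &
      forall k, `|u - grid (i k) k| <= 2^-1 ^+ k].
Proof.
move=> u0 u1; exists (fun k => Num.truncn (u * 2 ^+ k)).
have p2 k : 0 < 2 ^+ k :> R by rewrite exprn_gt0.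
have H k : (Num.truncn (u * 2 ^+ k))%:R <= u * 2 ^+ k < (Num.truncn (u * 2 ^+ k)).+1%:R.
  by rewrite truncn_itv// mulr_ge0// ltW.
split=> k; have /andP[h1 h2] := H k.
- rewrite -(ltr_nat R) natrX; apply: le_lt_trans h1 _.
  by rewrite -[ltRHS]mul1r ltr_pM2r.
- have /andP[h3 h4] := H k.+1; set j := Num.truncn _ in h3 h4 *.
  apply/esym/truncn_def/andP; move: h3 h4; rewrite exprS.
  rewrite -{1 2}(odd_double_half j) -[(odd j + _).+1]addn1 !natrD -mul2n natrM.
  rewrite mulrCA -[(j./2).+1]addn1 natrD; case: (odd j) => /=; split; lra.
- rewrite /grid; set j := Num.truncn _ in h1 h2 *.
  have e : 2 ^+ k * 2^-1 ^+ k = 1 :> R by rewrite -exprMn mulfV// expr1n.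
  have q : 0 <= 2^-1 ^+ k :> R by rewrite exprn_ge0.
  have -> : u - j%:R * 2^-1 ^+ k = (u * 2 ^+ k - j%:R) * 2^-1 ^+ k.
    by rewrite mulrBl -mulrA e mulr1.
  rewrite normrM (ger0_norm q) -[leRHS]mul1r ler_wpM2r//.
  by rewrite ger0_norm ?subr_ge0//; move: h2; rewrite -[j.+1]addn1 natrD; lra.
Qed.

Lemma half_pow_small (Q e : R) : 0 <= Q -> 0 < e -> exists K : nat, 2^-1 ^+ K * Q <= e.
Proof.
move=> Q0 e0; pose K := (Num.truncn (Q / e)).+1; exists K.
have h : Q / e < K%:R by rewrite truncnS_gt.
have h2 : K%:R <= 2 ^+ K :> R by rewrite -natrX ler_nat ltnW// ltn_expl.
rewrite exprVn mulrC ler_pdivrMr ?exprn_gt0//.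
rewrite mulrC -ler_pdivrMr//; exact: le_trans (ltW h) h2.
Qed.

End DyadicGrid.

(** * Uniform deviation over all cells *)

Section Chaining.
Context {R : realType} (d d' : measure_display) (T : measurableType d)
  (E : measurableType d') (P : probability T R) (n : nat) (D : 'I_n -> T -> E).
Hypothesis mD : forall i, measurable_fun setT (D i).
Hypothesis ind : forall S : 'I_n -> set E, (forall i, measurable (S i)) ->
    P (\bigcap_(i in [set: 'I_n]) (D i @^-1` S i)) =
    (\prod_(i < n) P (D i @^-1` S i))%E.
Hypothesis n0 : (0 < n)%N.

(** [C] indexes the cells and [u], [v] are local coordinates in a cell. The envelope [X c], of mean
    [m c], controls both the size and the increments of [Y c]. [h2] stands for the squared
    bandwidth; [rho] bounds the total mean mass and, per unit of [h2], the mean mass of each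
    cell. *)
Variables (C : finType) (X : C -> E -> R) (Y : C -> R -> R -> E -> R) (m : C -> R).
Variables (b h2 rho delta x0 : R).
Hypothesis mX : forall c, measurable_fun setT (X c).
Hypothesis X0 : forall c e, 0 <= X c e.
Hypothesis Xm : forall c i, (\int[P]_t (X c (D i t))%:E = (m c)%:E)%E.
Hypothesis X1 : forall c i, {ae P, forall t, X c (D i t) <= 1}.
Hypothesis mY : forall c u v, measurable_fun setT (Y c u v).
Hypothesis Y_bounded : forall c u v e, `|Y c u v e| <= 2 * b * X c e.
Hypothesis Y_lipschitz : forall c u v u' v' e,
  `|Y c u v e - Y c u' v' e| <= b * (`|u - u'| + `|v - v'|) * X c e.
Hypotheses (b0 : 0 < b) (h20 : 0 < h2) (rho0 : 0 < rho) (delta0 : 0 < delta).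
Hypothesis m_le : forall c, m c <= rho * h2.
Hypothesis sum_m_le : \sum_c m c <= rho.
Hypothesis x00 : 0 < x0.
Let x : R := ln ((delta * h2)^-1).
Hypothesis x0x : x0 <= x.
Let N : R := n%:R * h2.

(** The link from a grid point of level [k] to its parent of level [k - 1]; at level 0 it is the
    value of [Y] itself, so that the links of a chain sum to the value at its finest point. *)
Definition increment c k i j e : R := Y c (grid i k) (grid j k) e -
  (if k is k'.+1 then Y c (grid i./2 k') (grid j./2 k') e else 0).

(* [a k] bounds the increments of level [k], [th k] is the product of [a k] and
   the Chernoff parameter, [y k] the threshold of the exponent; the term
   [7 * (k.+1)] pays for the [4 ^+ k] increments of level [k], as [8 <= expR 7]. *)
Let a k : R := 2 * b * 2^-1 ^+ k.
Let xk (k : nat) : R := x + 7 * (k.+1)%:R.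
Let rk (k : nat) : R := xk k / N.
Let th (k : nat) : R := Num.min 1 (Num.sqrt (rk k)).
Let y (k : nat) : R := (1 + 2 * rho) * xk k.

Let N0 : 0 < N. Proof. by rewrite mulr_gt0// ltr0n. Qed.
Let x_gt0 : 0 < x. Proof. exact: lt_le_trans x0x. Qed.
Let a0 k : 0 < a k. Proof. by rewrite !mulr_gt0// exprn_gt0// invr_gt0. Qed.
Let xk7 k : 7 <= xk k.
Proof.
rewrite /xk -natr1; have : 0 <= k%:R :> R by [].
by have := x_gt0; lra.
Qed.
Let rk0 k : 0 < rk k.
Proof. by rewrite divr_gt0//; apply: lt_le_trans (xk7 k). Qed.
Let th0 k : 0 < th k.
Proof. by rewrite lt_min ltr01/= sqrtr_gt0. Qed.

Lemma measurable_increment c k i j : measurable_fun setT (increment c k i j).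
Proof. by apply: measurable_funB => //; case: k. Qed.

Lemma increment_bounded c k i j e : `|increment c k i j e| <= a k * X c e.
Proof.
rewrite /increment /a; case: k => [|k].
  by rewrite subr0 expr0 mulr1.
apply: le_trans (Y_lipschitz _ _ _ _ _ _) _.
rewrite ler_wpM2r// (mulrC 2) -mulrA ler_pM2l//.
have := @grid_half R i k; have := @grid_half R j k; lra.
Qed.

(** A crude bound, depending on [t]; it only serves to pass from grid points to arbitrary points. *)
Lemma centered_sum_bounded c (q : R) (f : E -> R) t : measurable_fun setT f ->
  (forall e, `|f e| <= q * X c e) -> 0 <= q ->
  `|centered_sum P D f t| <= q * (\sum_(i < n) (X c (D i t) + m c)).
Proof.
move=> mf fX q0; rewrite /centered_sum mulr_sumr.
apply: le_trans (ler_norm_sum _ _ _) _; apply: ler_sum => i _.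
rewrite mulrDr; apply: le_trans (ler_normB _ _) _; apply: lerD => //.
rewrite -lee_fin -abse_EFin -(meanE mD (mX c) (X0 c) (Xm c) i mf fX).
have mfi : measurable_fun setT (EFin \o (fun t => f (D i t))).
  by apply/measurable_EFinP; apply: measurableT_comp.
apply: le_trans (le_abse_integral _ _ _) _ => //.
rewrite EFinM -(Xm c i) -ge0_integralZl//; last 2 first.
- by apply/measurable_EFinP; apply: measurableT_comp.
- by move=> s _; rewrite lee_fin.
apply: ge0_le_integral => //.
- by apply: measurableT_comp => //.
- by apply: measurable_funeM; apply/measurable_EFinP; apply: measurableT_comp.
- by move=> s _; rewrite -EFinM lee_fin.
Qed.

(* Markov's inequality is applied once, to the sum over [k] of the [W k]: the
   weights [2 * expR (- y k)] make [W k t < 1] force every increment of level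
   [k] below its threshold. *)
Let W k t : R := \sum_(p : C * 'I_(2 ^ k) * 'I_(2 ^ k))
  2 * expR (- y k) *
  cosh2 (th k / a k * centered_sum P D (increment p.1.1 k p.1.2 p.2) t).

Let W0 k t : 0 <= W k t.
Proof. by apply: sumr_ge0 => p _; rewrite mulr_ge0 ?cosh2_ge0// mulr_ge0// expR_ge0. Qed.

Lemma measurable_cosh2 (f : T -> R) : measurable_fun setT f ->
  measurable_fun setT (fun t => cosh2 (f t)).
Proof.
move=> mf; apply: measurable_funB => //; apply: measurable_funD;
  apply: measurableT_comp => //; exact: measurableT_comp.
Qed.

Let mWp k c i j : measurable_fun setT (fun t => 2 * expR (- y k) *
  cosh2 (th k / a k * centered_sum P D (increment c k i j) t)).
Proof.
apply: measurable_funM => //; apply: measurable_cosh2; apply: measurable_funM => //.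
by apply: measurable_centered_sum => //; exact: measurable_increment.
Qed.

Let mW k : measurable_fun setT (W k).
Proof. by apply: measurable_sum => p; exact: mWp. Qed.

(** By the choice of [x], [expR (- x) = delta * h2]; and [8 = 1 + 7 <= expR 7] gives a factor [8^-1]
    for each of the [k.+1] multiples of 7. *)
Let expR_xk k : expR (- xk k) <= delta * h2 * 8^-1 ^+ k.+1.
Proof.
rewrite /xk opprD expRD /x lnV ?posrE ?mulr_gt0// opprK lnK ?posrE ?mulr_gt0//.
rewrite ler_pM2l ?mulr_gt0// -mulNr expRM_natr.
rewrite lerXn2r ?nnegrE ?expR_ge0//.
rewrite expRN lef_pV2 ?posrE ?expR_gt0//.
by apply: le_trans (expR_ge1Dx _); lra.
Qed.

(** A term of cell [c] has mean at most [4 * expR (- xk k) / (rho * h2) * m c]. Summing over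
    [4 ^+ k] index pairs and over cells of total mass at most [rho] leaves
    [4 ^+ k.+1 * expR (- xk k) / h2], and [4 / 8] per level gives the power of 2. *)
Let EW k : (\int[P]_t (W k t)%:E <= (delta / (2 ^ k.+1)%:R)%:E)%E.
Proof.
rewrite /W; under eq_integral do rewrite -sumEFin.
rewrite ge0_integral_sum//; last 2 first.
- by move=> p; apply/measurable_EFinP; exact: mWp.
- by move=> p t _; rewrite lee_fin mulr_ge0 ?cosh2_ge0// mulr_ge0// expR_ge0.
have mb0 : 0 < rho * h2 by rewrite mulr_gt0.
have key (p : C * 'I_(2 ^ k) * 'I_(2 ^ k)) :
    (\int[P]_t (2 * expR (- y k) *
      cosh2 (th k / a k * centered_sum P D (increment p.1.1 k p.1.2 p.2) t))%:E
     <= (4 * expR (- xk k) / (rho * h2) * m p.1.1)%:E)%E.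
  under eq_integral do rewrite EFinM.
  rewrite ge0_integralZl//; last 2 first.
  - apply/measurable_EFinP; apply: measurable_cosh2; apply: measurable_funM => //.
    by apply: measurable_centered_sum => //; exact: measurable_increment.
  - by move=> t _; rewrite lee_fin cosh2_ge0.
  set c := p.1.1.
  have := @cosh2_centered_sum_le _ _ _ _ _ P n D mD ind (X c) (m c) (mX c) (X0 c) (Xm c)
    (X1 c) (a k) (increment c k p.1.2 p.2) (th k / a k) (th k) (rho * h2)
    (measurable_increment _ _ _ _) (increment_bounded _ _ _ _) _ (ltW (th0 k)) _ n0 mb0 (m_le c).
  rewrite gtr0_norm ?divr_gt0// divfK ?gt_eqF// lexx ge_min lexx => /(_ isT isT) L.
  apply: le_trans (lee_wpmul2l _ L) _; first by rewrite lee_fin mulr_ge0// expR_ge0.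
  rewrite -EFinM lee_fin.
  have mc0 : 0 <= m c by apply: (mean_bound_ge0 (X0 c) (Xm c) n0).
  (* By definition [th k ^+ 2 <= rk k = xk k / N]; the resulting exponent [2 * rho * xk k] is what
     the factor [1 + 2 * rho] in [y] pays for. *)
  have e1 : 2 * n%:R * th k ^+ 2 * (rho * h2) <= 2 * rho * xk k.
    have -> : 2 * n%:R * th k ^+ 2 * (rho * h2) = 2 * rho * (th k ^+ 2 * N) by rewrite /N; ring.
    rewrite ler_pM2l ?mulr_gt0// -ler_pdivlMr// -/(rk k) -[leRHS]sqr_sqrtr ?(ltW (rk0 k))//.
    by rewrite ler_sqr ?nnegrE ?sqrtr_ge0 ?(ltW (th0 k))// ge_min lexx orbT.
  have e2 : expR (- y k) * expR (2 * n%:R * th k ^+ 2 * (rho * h2)) <= expR (- xk k).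
    by rewrite -expRD ler_expR /y; lra.
  have q0 : 0 <= 4 * (m c / (rho * h2)) by rewrite mulr_ge0// divr_ge0// ltW.
  have := ler_wpM2l q0 e2; lra.
apply: (@le_trans _ _ (\sum_(p : C * 'I_(2 ^ k) * 'I_(2 ^ k))
    (4 * expR (- xk k) / (rho * h2) * m p.1.1)%:E)%E).
  by apply: lee_sum => p _; exact: key.
rewrite sumEFin lee_fin -mulr_sumr.
have -> : \sum_(p : C * 'I_(2 ^ k) * 'I_(2 ^ k)) m p.1.1 = 4 ^+ k * \sum_c m c.
  rewrite -(pair_bigA _ (fun (q : C * 'I_(2 ^ k)) (j : 'I_(2 ^ k)) => m q.1))/=.
  under eq_bigr do rewrite sumr_const card_ord.
  rewrite -(pair_bigA _ (fun (c : C) (j : 'I_(2 ^ k)) => m c *+ 2 ^ k))/=.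
  under eq_bigr do rewrite sumr_const card_ord -mulrnA -mulr_natl.
  by rewrite -mulr_sumr -expnMn natrX.
have s0 : 0 <= 4 ^+ k * 4 * expR (- xk k) / (rho * h2).
  by rewrite divr_ge0 ?(ltW mb0)// !mulr_ge0 ?exprn_ge0 ?expR_ge0.
have s1 := ler_wpM2l s0 sum_m_le.
have s2 : 4 ^+ k * 4 * expR (- xk k) / (rho * h2) * rho = 4 ^+ k.+1 * (expR (- xk k) / h2).
  by rewrite exprSr; field; rewrite !gt_eqF.
have s3 : expR (- xk k) / h2 <= delta * 8^-1 ^+ k.+1.
  by rewrite ler_pdivrMr// mulrAC; exact: expR_xk.
have s4 : 4 ^+ k.+1 * (delta * 8^-1 ^+ k.+1) = delta / (2 ^ k.+1)%:R :> R.
  rewrite mulrCA -exprMn natrX -exprVn; congr (_ * _ ^+ _).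
  by apply/eqP; rewrite eq_sym -subr_eq0; apply/eqP; field.
have s5 := ler_wpM2l (exprn_ge0 k.+1 (ler0n R 4)) s3.
rewrite -s4; apply: le_trans s5; rewrite -s2; apply: le_trans s1.
by rewrite [leLHS](_ : _ = 4 ^+ k * 4 * expR (- xk k) / (rho * h2) * \sum_c m c)//; ring.
Qed.

(** The sum [V] of all [W k] has mean at most [delta], so by Markov's inequality [V < 1] outside an
    event of probability at most [delta]. An increment above its threshold would alone contribute
    [2 * expR (- y k) * (expR (y k) / 2) = 1]. *)
Lemma small_increments_event : exists A : set T, [/\ measurable A,
  ((1 - delta)%:E <= P A)%E &
  forall t, A t -> forall c k (i j : nat), (i < 2 ^ k)%N -> (j < 2 ^ k)%N ->
    `|th k / a k * centered_sum P D (increment c k i j) t| <= y k].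
Proof.
pose V t : \bar R := (\sum_(0 <= k <oo) (W k t)%:E)%E.
have V0 t : (0 <= V t)%E by apply: nneseries_ge0 => k _ _; rewrite lee_fin.
have mV : measurable_fun setT V.
  apply: ge0_emeasurable_sum => //; first by move=> k t _ _; rewrite lee_fin.
  by move=> k _; apply/measurable_EFinP.
have EV : (\int[P]_t V t <= delta%:E)%E.
  rewrite integral_nneseries//; last 2 first.
  - by move=> k; apply/measurable_EFinP.
  - by move=> k t _; rewrite lee_fin.
  apply: le_trans (epsilon_trick0 xpredT (ltW delta0)).
  apply: lee_nneseries => [k _ _|k _]; last exact: EW.
  by apply: integral_ge0 => t _; rewrite lee_fin.
exists (~` [set t | (1%:E <= `|V t|)%E]); split.
- by apply: measurableC; rewrite -[X in measurable X]setTI; apply: emeasurable_fun_c_infty => //; apply: measurableT_comp.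
- have mB : measurable [set t | (1%:E <= `|V t|)%E].
    by rewrite -[X in measurable X]setTI; apply: emeasurable_fun_c_infty => //; apply: measurableT_comp.
  rewrite probability_setC// EFinB leeB//.
  have := @le_integral_comp_abse _ _ _ P setT measurableT V 1 id (@measurable_id _ _ _) (fun _ h => h) (fun _ _ _ _ h => h) mV ltr01.
  rewrite mul1e setTI => L; apply: le_trans L _.
  by under eq_integral do rewrite gee0_abs//.
move=> t /negP; rewrite -ltNge gee0_abs// => Vt c k i j ik jk.
have Wt : W k t < 1.
  rewrite -lte_fin; apply: le_lt_trans Vt; rewrite /V.
  rewrite (@nneseriesD1 _ _ k)//; last by move=> l _; rewrite lee_fin.
  by rewrite leeDl//; apply: nneseries_ge0 => l _ _; rewrite lee_fin.
have Wt1 : 2 * expR (- y k) * cosh2 (th k / a k * centered_sum P D (increment c k i j) t) < 1.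
  apply: le_lt_trans Wt; rewrite /W (bigD1 (c, Ordinal ik, Ordinal jk))//= lerDl.
  by apply: sumr_ge0 => p _; rewrite mulr_ge0 ?cosh2_ge0// mulr_ge0// expR_ge0.
rewrite leNgt; apply/negP => yS.
have y3 : 3 <= y k.
  have h7 := xk7 k; apply: (@le_trans _ _ (xk k)); first lra.
  by rewrite /y ler_peMl ?lerDl ?mulr_ge0 ?(ltW rho0)//; lra.
have tail := cosh2_tail y3 (ltW yS).
move: Wt1; rewrite ltNge => /negP; apply.
have := expR_gt0 (y k); have : expR (- y k) * expR (y k) = 1 by rewrite -expRD addNr expR0.
have := expR_gt0 (- y k).
move: tail; set s := cosh2 _; nra.
Qed.

(** The two regimes of Bernstein's inequality: [th k = 1] gives the linear term,
    [th k = Num.sqrt (rk k)] the square root. Since [x >= x0], the term [7 * k.+1] of [xk k] is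
    absorbed into [7 / x0 * k.+1 * x]. *)
Let rk_th k : rk k / th k <= (1 + 7 / x0) * k.+1%:R * Num.max (x / N) (Num.sqrt (x / N)).
Proof.
set A := (1 + 7 / x0) * k.+1%:R; set r := x / N.
have A1 : 1 <= A.
  by rewrite -[1]mulr1 ler_pM// ?ler1n// lerDl divr_ge0// ltW.
have r0 : 0 < r by rewrite divr_gt0.
have rA : rk k <= A * r.
  rewrite /rk /A /r mulrA ler_pM2r ?invr_gt0// /xk.
  have : 1 <= x / x0 by rewrite ler_pdivlMr// mul1r.
  have k1 : 1 <= k.+1%:R :> R by rewrite ler1n.
  rewrite -[7 / x0 ]/(7 / x0) mulrDl mul1r mulrDl => h.
  have : x <= k.+1%:R * x by rewrite ler_peMl// ltW.
  have : 7 * k.+1%:R <= 7 / x0 * k.+1%:R * x.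
    rewrite [leRHS](_ : _ = 7 * k.+1%:R * (x / x0)); last by ring.
    by rewrite ler_peMr// mulr_ge0.
  lra.
rewrite /th; have [_|s1] := leP 1 (Num.sqrt (rk k)).
  rewrite divr1; apply: le_trans rA _; rewrite ler_wpM2l ?(le_trans _ A1)//.
  by rewrite le_max lexx.
rewrite -{1}[rk k]sqr_sqrtr ?(ltW (rk0 k))// expr2 mulfK ?gt_eqF ?sqrtr_gt0//.
apply: (@le_trans _ _ (Num.sqrt (A * r))); first by rewrite ler_wsqrtr.
apply: (@le_trans _ _ (A * Num.sqrt r)); last first.
  by rewrite ler_wpM2l ?(le_trans _ A1)// le_max lexx orbT.
rewrite sqrtrM ?(le_trans _ A1)// ler_wpM2r ?sqrtr_ge0//.
rewrite -[leRHS]ger0_norm ?(le_trans _ A1)// -sqrtr_sqr ler_wsqrtr//.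
by rewrite expr2 ler_peMl// (le_trans _ A1).
Qed.

(** The threshold of level [k] is proportional to [2^-1 ^+ k * k.+1], and these sum to at most 4.
    With the factor 2 of [a k] this is the 8 of the bound. *)
Lemma uniform_deviation : exists A : set T, [/\ measurable A,
  ((1 - delta)%:E <= P A)%E &
  forall t, A t -> forall c (u v : R), 0 <= u -> u < 1 -> 0 <= v -> v < 1 ->
    `|n%:R^-1 * centered_sum P D (Y c u v) t| <=
    8 * (b * h2) * (1 + 2 * rho) * (1 + 7 / x0) * Num.max (x / N) (Num.sqrt (x / N))].
Proof.
have [A [mA PA HA]] := small_increments_event.
exists A; split => // t At c u v u0 u1 v0 v1.
set mx := Num.max _ _; set G := (1 + 2 * rho) * (1 + 7 / x0).
have mx0 : 0 <= mx by rewrite le_max divr_ge0// ltW.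
have [i [i1 i2 i3]] := grid_approx u0 u1; have [j [j1 j2 j3]] := grid_approx v0 v1.
have n0' : 0 < n%:R :> R by rewrite ltr0n.
have step k : `|centered_sum P D (increment c k (i k) (j k)) t| <=
    2 * (n%:R * (b * h2)) * G * mx * (2^-1 ^+ k * k.+1%:R).
  have := HA t At c k (i k) (j k) (i1 k) (j1 k).
  rewrite normrM gtr0_norm ?divr_gt0// mulrC -ler_pdivlMr ?divr_gt0// => /le_trans; apply.
  rewrite invf_div.
  have -> : y k * (a k / th k) = n%:R * h2 * (1 + 2 * rho) * a k * (rk k / th k).
    by rewrite /y /rk /N; field; rewrite !gt_eqF.
  have q0 : 0 <= n%:R * h2 * (1 + 2 * rho) * a k.
    by rewrite !mulr_ge0 ?exprn_ge0 ?(ltW b0) ?(ltW h20)//; have := rho0; lra.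
  apply: le_trans (ler_wpM2l q0 (rk_th k)) _.
  by rewrite /a /G -/mx le_eqVlt; apply/orP; left; apply/eqP; ring.
have cS := centered_sumB mD (mX c) (X0 c) (Xm c).
(* The grid points approximating [u] and [v] at successive levels are parent and child, so the
   increments telescope. *)
have tele K : centered_sum P D (Y c (grid (i K) K) (grid (j K) K)) t =
    \sum_(k < K.+1) centered_sum P D (increment c k (i k) (j k)) t.
  elim: K => [|K IH].
    rewrite big_ord1; congr centered_sum; apply/funext => e.
    by rewrite /increment subr0.
  rewrite big_ord_recr/= -IH /increment i2 j2.
  by rewrite (cS (2 * b) (2 * b))// addrC subrK.
have gridb K : `|centered_sum P D (Y c (grid (i K) K) (grid (j K) K)) t| <=
    8 * (n%:R * (b * h2)) * G * mx.
  rewrite tele; apply: le_trans (ler_norm_sum _ _ _) _.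
  apply: (@le_trans _ _ (\sum_(k < K.+1)
    2 * (n%:R * (b * h2)) * G * mx * (2^-1 ^+ k * k.+1%:R))).
    by apply: ler_sum => k _; exact: step.
  rewrite -mulr_sumr; have := @sum_dyadic_le4 R K.+1.
  have q0 : 0 <= 2 * (n%:R * (b * h2)) * G * mx.
    rewrite !mulr_ge0//; try exact: ltW.
    - by rewrite addr_ge0// mulr_ge0// ltW.
    - by rewrite addr_ge0// divr_ge0// ltW.
  move/(ler_wpM2l q0)/le_trans; apply; lra.
(* The level [K] may depend on [t] and on the error [e], since the event [A] controls all levels at
   once. *)
have lim : `|centered_sum P D (Y c u v) t| <= 8 * (n%:R * (b * h2)) * G * mx.
  apply/ler_addgt0Pr => e e0.
  set Q := \sum_(l < n) (X c (D l t) + m c).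
  have Q0 : 0 <= 2 * b * Q.
    apply: mulr_ge0; first by rewrite mulr_ge0// ltW.
    apply: sumr_ge0 => l _; apply: addr_ge0 => //.
    exact: (mean_bound_ge0 (X0 c) (Xm c) n0).
  have [K HK] := half_pow_small Q0 e0.
  have dif : `|centered_sum P D (Y c u v) t -
      centered_sum P D (Y c (grid (i K) K) (grid (j K) K)) t| <= e.
    rewrite -(cS (2 * b) (2 * b))//.
    apply: le_trans HK.
    have -> : 2^-1 ^+ K * (2 * b * Q) = 2^-1 ^+ K * 2 * b * Q by ring.
    apply: centered_sum_bounded.
    - by apply: measurable_funB.
    - move=> z; apply: le_trans (Y_lipschitz _ _ _ _ _ _) _.
      rewrite ler_wpM2r// mulrC ler_pM2r//.
      by have := i3 K; have := j3 K; lra.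
    - by rewrite !mulr_ge0 ?exprn_ge0// ltW.
  rewrite -[X in `|X|](subrK (centered_sum P D (Y c (grid (i K) K) (grid (j K) K)) t)).
  by apply: le_trans (ler_normD _ _) _; rewrite addrC lerD.
rewrite normrM gtr0_norm ?invr_gt0// mulrC ler_pdivrMr//.
apply: le_trans lim _; rewrite /G le_eqVlt; apply/orP; left; apply/eqP; ring.
Qed.

End Chaining.

(** * Sums over diagrams *)

(* The diagrams as a measurable space for the sigma-algebra [diagram_events]. *)
Definition diagram_space (R : realType) : Type := diagram R.

HB.instance Definition _ (R : realType) := Choice.on (diagram_space R).
HB.instance Definition _ (R : realType) :=
  isPointed.Build (diagram_space R) (mset0 : diagram R).

Lemma diagram_events0 (R : realType) : @diagram_events R set0.
Proof. exact: sigma_algebra0. Qed.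

Lemma diagram_eventsC (R : realType) (A : set (diagram R)) :
  diagram_events A -> diagram_events (~` A).
Proof. by move=> ?; rewrite -setTD; exact: sigma_algebraCD. Qed.

Lemma diagram_eventsU (R : realType) (F : (set (diagram R))^nat) :
  (forall i, diagram_events (F i)) -> diagram_events (\bigcup_i F i).
Proof. exact: sigma_algebra_bigcup. Qed.

HB.instance Definition _ (R : realType) :=
  @isMeasurable.Build default_measure_display (diagram_space R)
    (@diagram_events R) (@diagram_events0 R) (@diagram_eventsC R) (@diagram_eventsU R).

Section DiagramSums.
Context {R : realType}.

Lemma funrpos_funrnegE (T : Type) (g : T -> R) x : g^\+ x - g^\- x = g x.
Proof. exact: (congr1 (fun f : T -> R => f x) (funrposBneg g)). Qed.

Definition dsum (g : plane R -> R) (D : diagram R) : R :=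
  \sum_(r <- enum_mset D) g r.

Lemma ge0_integral_pmeasure (A : set (plane R)) (g : plane R -> R) D :
  measurable A -> measurable_fun setT g -> (forall x, 0 <= g x) ->
  (\int[pmeasure D]_(x in A) (g x)%:E = (dsum (fun x => \1_A x * g x) D)%:E)%E.
Proof.
move=> mA mg g0; rewrite /pmeasure ge0_integral_measure_sum//; last 2 first.
- by move=> x _; rewrite lee_fin.
- by apply/measurable_EFinP; exact: measurable_funTS.
rewrite /dsum (big_nth ((0, 0) : plane R)) big_mkord -sumEFin; apply: eq_bigr => i _.
have mgA : measurable_fun A (fun x => (g x)%:E).
  by apply/measurable_EFinP; exact: measurable_funTS.
by rewrite (integral_dirac _ mA mgA) diracE -EFinM indicE.
Qed.

Lemma pmeasureE (A : set (plane R)) D : pmeasure D A = (dsum \1_A D)%:E.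
Proof.
rewrite /pmeasure /msum /dsum (big_nth ((0, 0) : plane R)) big_mkord -sumEFin.
by apply: eq_bigr => i _; rewrite /= diracE indicE.
Qed.

Lemma npmeasureE (A : set (plane R)) D :
  npmeasure D A = ((size (enum_mset D))%:R^-1 * dsum \1_A D)%:E.
Proof. by rewrite EFinM -pmeasureE. Qed.

Lemma dsumB (f g : plane R -> R) D :
  dsum (fun x => f x - g x) D = dsum f D - dsum g D.
Proof. by rewrite /dsum -sumrB. Qed.

Lemma dsum_ge0 (f : plane R -> R) D : (forall x, 0 <= f x) -> 0 <= dsum f D.
Proof. by move=> f0; apply: sumr_ge0. Qed.

Lemma norm_dsum_le (f g : plane R -> R) D : (forall x, `|f x| <= g x) ->
  `|dsum f D| <= dsum g D.
Proof.
by move=> fg; apply: le_trans (ler_norm_sum _ _ _) _; apply: ler_sum => r _.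
Qed.

(** As an integral against [pmeasure], the sum is measurable because the evaluations [pmeasure D A]
    are, by the definition of [diagram_events]. *)
Lemma ge0_measurable_dsum (g : plane R -> R) : measurable_fun setT g ->
  (forall x, 0 <= g x) -> measurable_fun setT (dsum g : diagram_space R -> R).
Proof.
move=> mg g0; apply/measurable_EFinP.
have -> : EFin \o (dsum g : diagram_space R -> R) =
    (fun D : diagram_space R => \int[pmeasure D]_x (g x)%:E)%E.
  apply/funext => D /=; rewrite ge0_integral_pmeasure//.
  by congr EFin; apply: eq_bigr => r _; rewrite indicT mul1r.
apply: (@measurable_fun_integral_kernel _ _ (diagram_space R) _ R
  (fun D : diagram_space R => pmeasure D)) => //.
- move=> U mU _ B mB; rewrite setTI; apply: sub_sigma_algebra.
  by exists U, B; split.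
- exact/measurable_EFinP.
Qed.

Lemma measurable_dsum (g : plane R -> R) : measurable_fun setT g ->
  measurable_fun setT (dsum g : diagram_space R -> R).
Proof.
move=> mg.
have -> : dsum g = (fun D => dsum g^\+ D - dsum g^\- D).
  by apply/funext => D; rewrite -dsumB; apply: eq_bigr => r _; rewrite funrpos_funrnegE.
apply: measurable_funB; apply: ge0_measurable_dsum => //.
- exact: measurable_funrpos.
- exact: measurable_funrneg.
Qed.

Lemma Rintegral_pmeasure (A : set (plane R)) (g : plane R -> R) D :
  measurable A -> measurable_fun setT g ->
  \int[pmeasure D]_(x in A) g x = dsum (fun x => \1_A x * g x) D.
Proof.
move=> mA mg; rewrite /Rintegral integralE.
have -> : (fun x => (g x)%:E)^\+%E = EFin \o g^\+ by exact: funerpos.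
have -> : (fun x => (g x)%:E)^\-%E = EFin \o g^\- by exact: funerneg.
rewrite !ge0_integral_pmeasure//; last 2 first.
- exact: measurable_funrneg.
- exact: measurable_funrpos.
rewrite -EFinB/= -dsumB; apply: eq_bigr => r _.
by rewrite -mulrBr funrpos_funrnegE.
Qed.

Lemma Rintegral_npmeasure (A : set (plane R)) (g : plane R -> R) D :
  measurable A -> measurable_fun setT g ->
  \int[npmeasure D]_(x in A) g x =
  (size (enum_mset D))%:R^-1 * dsum (fun x => \1_A x * g x) D.
Proof.
move=> mA mg; rewrite /Rintegral integralE.
have -> : (fun x => (g x)%:E)^\+%E = EFin \o g^\+ by exact: funerpos.
have -> : (fun x => (g x)%:E)^\-%E = EFin \o g^\- by exact: funerneg.
have mp := measurable_funrpos mg; have mn := measurable_funrneg mg.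
have key (f : plane R -> R) : measurable_fun setT f -> (forall x, 0 <= f x) ->
    (\int[npmeasure D]_(x in A) (f x)%:E =
     ((size (enum_mset D))%:R^-1 * dsum (fun x => \1_A x * f x) D)%:E)%E.
  move=> mf f0; rewrite EFinM -ge0_integral_pmeasure//.
  apply: ge0_integral_mscale => //.
  - by apply/measurable_EFinP; exact: measurable_funTS.
  - by move=> x _; rewrite lee_fin.
rewrite !key//= -mulrBr -dsumB; congr (_ * _).
by apply: eq_bigr => r _; rewrite -mulrBr -[in RHS](funrposBneg g).
Qed.

Lemma dsum_size D : dsum (fun=> 1) D = (size (enum_mset D))%:R.
Proof. by rewrite /dsum big_const_seq count_predT iter_addr_0. Qed.

(** The size takes countably many values, so a preimage is a countable union of level sets of
    [dsum (fun=> 1)]. *)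
Lemma measurable_size_inv :
  measurable_fun setT (fun D : diagram_space R => (size (enum_mset D))%:R^-1 : R).
Proof.
move=> _ B mB; rewrite setTI.
have -> : (fun D : diagram_space R => (size (enum_mset D))%:R^-1 : R) @^-1` B =
    \bigcup_(k in [set k : nat | B (k%:R^-1)]) (dsum (fun=> 1) @^-1` [set (k%:R : R)]).
  apply/seteqP; split => [D BD|D [k Bk /=]].
    by exists (size (enum_mset D)) => //=; rewrite dsum_size.
  by rewrite dsum_size => ->.
apply: bigcup_measurable => k _; rewrite -[X in measurable X]setTI.
by have := @measurable_dsum (fun=> 1) (measurable_cst _) measurableT [set (k%:R : R)]; apply; exact: measurable_set1.
Qed.

End DiagramSums.

(** * Geometry of the cells *)

Section PlaneGeometry.
Context {R : realType}.
Implicit Types (x y w z : plane R).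

Lemma enorm_ge0 x : 0 <= enorm x.
Proof. exact: sqrtr_ge0. Qed.

Lemma enorm_sqr x : enorm x ^+ 2 = (x.1 : R) ^+ 2 + (x.2 : R) ^+ 2.
Proof. by rewrite sqr_sqrtr// addr_ge0// sqr_ge0. Qed.

Lemma enorm_coord x : `|(x.1 : R)| <= enorm x /\ `|(x.2 : R)| <= enorm x.
Proof.
by split; rewrite -sqrtr_sqr ler_wsqrtr// ?lerDl ?lerDr sqr_ge0.
Qed.

Lemma enorm_le_l1 x : enorm x <= `|(x.1 : R)| + `|(x.2 : R)|.
Proof.
have p : 0 <= `|(x.1 : R)| + `|(x.2 : R)| by rewrite addr_ge0.
rewrite -ler_sqr ?nnegrE ?enorm_ge0// enorm_sqr sqrrD !real_normK ?num_real//.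
by rewrite lerD2r lerDl mulrn_wge0// mulr_ge0.
Qed.

Lemma enorm_triangle x y z :
  enorm (psub x z) <= enorm (psub x y) + enorm (psub y z).
Proof.
have p : 0 <= enorm (psub x y) + enorm (psub y z) by rewrite addr_ge0 ?enorm_ge0.
rewrite -ler_sqr ?nnegrE ?enorm_ge0// sqrrD !enorm_sqr.
set s := enorm (psub x y); set r := enorm (psub y z).
have hs := enorm_sqr (psub x y); have hr := enorm_sqr (psub y z).
have s0 := enorm_ge0 (psub x y); have r0 := enorm_ge0 (psub y z).
rewrite -/s in hs s0; rewrite -/r in hr r0; rewrite /psub/= in hs hr *.
set a := (x.1 : R) - y.1 in hs *; set b := (x.2 : R) - y.2 in hs *.
set u := (y.1 : R) - z.1 in hr *; set v := (y.2 : R) - z.2 in hr *.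
have -> : (x.1 : R) - z.1 = a + u by rewrite /a /u; ring.
have -> : (x.2 : R) - z.2 = b + v by rewrite /b /v; ring.
(* Cauchy-Schwarz from Lagrange's identity: the squares differ by [(a * v - b * u) ^+ 2]. *)
have cs : a * u + b * v <= s * r.
  apply: le_trans (ler_norm _) _.
  rewrite -ler_sqr ?nnegrE ?mulr_ge0// real_normK ?num_real// exprMn hs hr.
  rewrite -subr_ge0 (_ : _ - _ = (a * v - b * u) ^+ 2) ?sqr_ge0//; ring.
rewrite mulr2n; lra.
Qed.

Lemma psubC_enorm x y : enorm (psub x y) = enorm (psub y x).
Proof. by rewrite /enorm /psub/=; congr Num.sqrt; ring. Qed.

Lemma dist_bd_lipschitz (L : R) x y : 0 < L ->
  dist_bd L x <= dist_bd L y + enorm (psub x y).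
Proof.
move=> L0.
have ne z : [set enorm (psub z w) | w in bdOmega L] !=set0.
  by exists (enorm (psub z (0, 0))), (0, 0) => //; split => //=; rewrite lexx ltW.
have lb z : has_lbound [set enorm (psub z w) | w in bdOmega L].
  by exists 0 => _ [w _ <-]; exact: enorm_ge0.
rewrite -lerBlDr; apply: lb_le_inf => // _ [w wb <-].
rewrite lerBlDr addrC; apply: le_trans (enorm_triangle x y w).
by apply: ge_inf => //; exists w.
Qed.

(** A Lipschitz [f] is the infimum over rational points [q] of [f q] plus [c] times the l1 distance
    to [q]; hence its sublevel sets are countable unions of measurable sets. *)
Lemma measurable_lipschitz (f : plane R -> R) (c : R) : 0 <= c ->
  (forall x y, `|f x - f y| <= c * (`|(x.1 : R) - y.1| + `|(x.2 : R) - y.2|)) ->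
  measurable_fun setT f.
Proof.
move=> c0 fL.
have ratP (a e : R) : 0 < e -> exists q : rat, `|a - ratr q| < e.
  move=> e0; have ae : a - e < a + e by lra.
  have [q] := rat_in_itvoo ae; rewrite in_itv/= => /andP[h1 h2].
  by exists q; rewrite ltr_norml; apply/andP; split; lra.
apply: (measurability _ (RGenInftyO.measurableE R)) => //.
move=> /= _ [_ [z ->] <-]; rewrite setTI.
pose S (q : rat * rat) := [set x : plane R |
  f (ratr q.1, ratr q.2) + c * (`|(x.1 : R) - ratr q.1| + `|(x.2 : R) - ratr q.2|) < z].
have -> : f @^-1` `]-oo, z[%classic = \bigcup_q S q.
  apply/seteqP; split => [x|x [q _]]; rewrite /= in_itv/=; last first.
    rewrite /S/= => h; apply: le_lt_trans h.
    have := fL x (ratr q.1, ratr q.2) => /=.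
    by rewrite ler_norml => /andP[_]; lra.
  (* Passing to the rational point and adding the distance term each cost at most [2 * c * e],
     together less than [4 * (c + 1) * e = z - f x]; the [+ 1] covers [c = 0]. *)
  move=> fz; pose e := (z - f x) / (4 * (c + 1)).
  have e0 : 0 < e by rewrite divr_gt0; lra.
  have [q1 h1] := ratP x.1 _ e0; have [q2 h2] := ratP x.2 _ e0.
  exists (q1, q2) => //; rewrite /S/=.
  have := fL x (ratr q1, ratr q2) => /=; rewrite ler_norml => /andP[h3 _].
  have h4 : c * (`|(x.1 : R) - ratr q1| + `|(x.2 : R) - ratr q2|) <= c * (2 * e).
    by rewrite ler_wpM2l//; lra.
  have h5 : 4 * ((c + 1) * e) = z - f x by rewrite /e; field; lra.
  lra.
apply: countable_bigcupT_measurable => // q.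
rewrite -[S q]setTI (_ : S q = (fun x : plane R => f (ratr q.1, ratr q.2) +
  c * (`|(x.1 : R) - ratr q.1| + `|(x.2 : R) - ratr q.2|)) @^-1` `]-oo, z[%classic).
  apply: (_ : measurable_fun setT _) => //.
  apply: measurable_funD => //; apply: measurable_funM => //.
  apply: measurable_funD; apply: measurableT_comp => //; apply: measurable_funB => //.
by apply/seteqP; split => x; rewrite /S/= in_itv.
Qed.

End PlaneGeometry.

(** * Bounds on the scaled kernel *)

Section ScaledKernel.
Context {R : realType} (K : plane R -> R) (LK h : R).
Hypothesis HK : kernel_conditions K LK.
Hypothesis h0 : 0 < h.

Let scale (x : plane R) : plane R := ((x.1 : R) / h, (x.2 : R) / h).

Lemma scaled_kernel_bounded x : `|scaled_kernel K h x| <= supnorm setT K / h ^+ 2.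
Proof.
rewrite /scaled_kernel normrM ger0_norm ?invr_ge0 ?exprn_ge0 ?(ltW h0)//.
rewrite mulrC ler_wpM2r ?invr_ge0 ?exprn_ge0 ?(ltW h0)//.
apply: ub_le_sup; first exact: kernel_bounded HK.
by exists (scale x).
Qed.

Lemma scaled_kernel_lipschitz x y : `|scaled_kernel K h x - scaled_kernel K h y| <=
  `|LK| / h ^+ 2 * ((`|(x.1 : R) - y.1| + `|(x.2 : R) - y.2|) / h).
Proof.
rewrite /scaled_kernel -mulrBr normrM ger0_norm ?invr_ge0 ?exprn_ge0 ?(ltW h0)//.
rewrite mulrAC (mulrC (h ^- 2)) ler_wpM2r ?invr_ge0 ?exprn_ge0 ?(ltW h0)//.
apply: le_trans (kernel_lipschitz HK (scale x) (scale y)) _.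
apply: (@le_trans _ _ (`|LK| * enorm (psub (scale x) (scale y)))).
  by rewrite ler_wpM2r ?enorm_ge0// ler_norm.
rewrite ler_wpM2l//; apply: le_trans (enorm_le_l1 _) _.
by rewrite /psub/= -!mulrBl !normrM (gtr0_norm (_ : 0 < h^-1)) ?invr_gt0// mulrDl.
Qed.

Lemma scaled_kernel_support x : h < enorm x -> scaled_kernel K h x = 0.
Proof.
move=> hx; rewrite /scaled_kernel (kernel_support HK) ?mulr0//.
rewrite -(ltr_pM2r h0) mul1r; apply: lt_le_trans hx _.
rewrite -ler_sqr ?nnegrE ?enorm_ge0 ?mulr_ge0 ?enorm_ge0 ?(ltW h0)//.
rewrite exprMn !enorm_sqr/= !expr_div_n -mulrDl divfK// gt_eqF// exprn_gt0//.
Qed.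

Lemma measurable_scaled_kernel w :
  measurable_fun setT (fun x => scaled_kernel K h (psub x w)).
Proof.
apply: (@measurable_lipschitz _ _ (`|LK| / h ^+ 2 / h)).
  by rewrite !mulr_ge0 ?invr_ge0 ?exprn_ge0 ?(ltW h0).
move=> x y; apply: le_trans (scaled_kernel_lipschitz _ _) _; rewrite /psub/=.
have e a b c : a - c - (b - c) = a - b :> R by ring.
by rewrite !e le_eqVlt; apply/orP; left; apply/eqP; ring.
Qed.

End ScaledKernel.

Lemma measurable_Omega {R : realType} (L : R) : measurable (Omega L).
Proof.
have m1 : measurable_fun setT (fun w : plane R => (w.1 : R)) by exact: measurable_fst.
have m2 : measurable_fun setT (fun w : plane R => (w.2 : R)) by exact: measurable_snd.
have -> : Omega L = ((fun w : plane R => (w.1 : R)) @^-1` `]0, +oo[%classic `&`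
   (fun w : plane R => (w.2 : R) - (w.1 : R)) @^-1` `]0, +oo[%classic) `&`
   (fun w : plane R => (w.2 : R)) @^-1` `]-oo, L]%classic.
  apply/seteqP; split => w /=; rewrite /Omega/= !in_itv/= !andbT subr_gt0.
    by case.
  by case=> -[].
apply: measurableI; [apply: measurableI|]; rewrite -[X in measurable X]setTI.
- by apply: m1 => //; exact: measurable_itv.
- by apply: (measurable_funB m2 m1) => //; exact: measurable_itv.
- by apply: m2 => //; exact: measurable_itv.
Qed.

(** * Covering of the triangle by squares of side [h] *)

Section Cells.
Context {R : realType} (L h : R).
Hypothesis h0 : 0 < h.

(** One more than the integer part of [L / h], so that the coordinate [L] itself falls into a
    cell. *)
Definition cells : nat := (Num.truncn (L / h)).+1.

Definition cell_point (c : 'I_cells * 'I_cells) (u v : R) : plane R :=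
  ((c.1%:R + u) * h, (c.2%:R + v) * h).

(** The cell enlarged by [h] on each side: it contains every point that the kernel sees from a point
    of the cell. *)
Definition cell_box (c : 'I_cells * 'I_cells) : set (plane R) :=
  `[(c.1%:R - 1) * h, (c.1%:R + 2) * h]%classic `*`
  `[(c.2%:R - 1) * h, (c.2%:R + 2) * h]%classic.

Lemma measurable_cell_box c : measurable (cell_box c).
Proof. by apply: measurableX; exact: measurable_itv. Qed.

Lemma leb2_cell_box c : leb2 (cell_box c) = (9 * h ^+ 2)%:E.
Proof.
rewrite /cell_box product_measure1E; [|exact: measurable_itv|exact: measurable_itv].
have side (i : nat) : lebesgue_measure `[(i%:R - 1) * h, (i%:R + 2) * h]%classic = (3 * h)%:E.
  rewrite lebesgue_measure_itv/= lte_fin ltr_pM2r// ltrD2l ifT; last by lra.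
  by rewrite -EFinB; congr EFin; ring.
transitivity ((3 * h)%:E * (3 * h)%:E)%E; first by congr (_ * _)%E; exact: side.
by rewrite -EFinM; congr EFin; ring.
Qed.

Lemma Omega_in_cell w : 0 < L -> Omega L w -> exists c u v,
  [/\ w = cell_point c u v, 0 <= u < 1 & 0 <= v < 1].
Proof.
move=> L0 [w1 w12 w2].
have coord (z : R) : 0 < z -> z <= L -> exists (i : 'I_cells) (u : R),
    z = (i%:R + u) * h /\ 0 <= u < 1.
  move=> z0 zL; have zh : 0 <= z / h by rewrite divr_ge0// ltW.
  have iN : (Num.truncn (z / h) < cells)%N.
    by rewrite ltnS le_truncn// ler_pM2r ?invr_gt0.
  exists (Ordinal iN), (z / h - (Num.truncn (z / h))%:R) => /=.
  rewrite addrC subrK divfK ?gt_eqF//; split => //.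
  have := truncn_itv zh; rewrite -[(Num.truncn _).+1]addn1 natrD => /andP[a b].
  by apply/andP; split; lra.
have [i [u [eu hu]]] := coord w.1 w1 (ltW (lt_le_trans w12 w2)).
have [j [v [ev hv]]] := coord w.2 (lt_trans w1 w12) w2.
exists (i, j), u, v; split => //; rewrite /cell_point/= -eu -ev; exact: surjective_pairing.
Qed.

Lemma cell_box_nbhd c (u v : R) x : 0 <= u < 1 -> 0 <= v < 1 ->
  enorm (psub x (cell_point c u v)) <= h -> cell_box c x.
Proof.
move=> /andP[u0 u1] /andP[v0 v1] xh.
have [h1 h2] := enorm_coord (psub x (cell_point c u v)).
have := le_trans h1 xh; have := le_trans h2 xh; rewrite /psub /cell_point/=.
rewrite !ler_norml => /andP[b1 b2] /andP[a1 a2].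
have uh : 0 <= u * h by rewrite mulr_ge0// ltW.
have vh : 0 <= v * h by rewrite mulr_ge0// ltW.
have uh1 : u * h <= h by rewrite ler_piMl ?ltW.
have vh1 : v * h <= h by rewrite ler_piMl ?ltW.
by split; rewrite /= in_itv/=; apply/andP; split; lra.
Qed.

(** A coordinate with integer part [j] in units of [h] can lie only in the intervals of index
    [j - 2] to [j + 1]; two coordinates give [4 * 4]. *)
Lemma sum_cell_box_le x : 0 <= (x.1 : R) -> 0 <= (x.2 : R) ->
  \sum_c \1_(cell_box c) x <= 16 :> R.
Proof.
move=> x1 x2.
have coord (z : R) : 0 <= z ->
    \sum_(i < cells) \1_(`[(i%:R - 1) * h, (i%:R + 2) * h]%classic) z <= 4 :> R.
  move=> z0; set j := Num.truncn (z / h).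
  have zh : 0 <= z / h by rewrite divr_ge0// ltW.
  have /andP[j1 j2] := truncn_itv zh; rewrite -/j in j1 j2.
  pose p (i : nat) := ((i <= j.+1) && (j <= i.+2))%N.
  apply: (@le_trans _ _ (\sum_(i < cells) (p i)%:R)).
    apply: ler_sum => i _; rewrite indicE; case: (boolP (z \in _)) => //= /set_mem.
    rewrite /= in_itv/= => /andP[]; rewrite -ler_pdivlMr// => a.
    rewrite -ler_pdivrMr// => b.
    suff -> : p i by [].
    apply/andP; split.
      rewrite -ltnS -(ltr_nat R) -[j.+2]addn2 natrD.
      by move: j2; rewrite -[j.+1]addn1 natrD; lra.
    by rewrite -(ler_nat R) -[i.+2]addn2 natrD; lra.
  rewrite -natr_sum ler_nat -(big_mkord xpredT (fun i => nat_of_bool (p i))).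
  rewrite -big_mkcond/= sum1_count -size_filter.
  rewrite -[leqRHS](size_iota (j - 2) 4); apply: uniq_leq_size.
    by apply: filter_uniq; exact: iota_uniq.
  move=> i; rewrite mem_filter mem_iota /p => /andP[/andP[a b] _].
  by apply/andP; split; lia.
have -> : \sum_c \1_(cell_box c) x =
    (\sum_(i < cells) \1_(`[(i%:R - 1) * h, (i%:R + 2) * h]%classic) (x.1 : R)) *
    (\sum_(j < cells) \1_(`[(j%:R - 1) * h, (j%:R + 2) * h]%classic) (x.2 : R)) :> R.
  rewrite mulr_suml -(pair_bigA _ (fun i j => \1_(cell_box (i, j)) x : R))/=.
  apply: eq_bigr => i _; rewrite mulr_sumr; apply: eq_bigr => j _.
  by rewrite !indicE -natrM mulnb /cell_box in_setX.
have p (z : R) : 0 <= \sum_(i < cells) \1_(`[(i%:R - 1) * h, (i%:R + 2) * h]%classic) z :> R.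
  by apply: sumr_ge0.
rewrite (_ : 16 = 4 * 4); last by ring.
by rewrite ler_pM// coord.
Qed.

End Cells.

(** * Deviation of the estimators *)

Lemma dsumZ {R : realType} (k : R) (f : plane R -> R) D :
  dsum (fun x => k * f x) D = k * dsum f D.
Proof. by rewrite /dsum mulr_sumr. Qed.

Lemma ler_dsum_in {R : realType} (f g : plane R -> R) (D : diagram R) :
  (forall r, r \in enum_mset D -> f r <= g r) -> dsum f D <= dsum g D.
Proof.
move=> fg; rewrite /dsum big_seq [leRHS]big_seq; apply: ler_sum => r; exact: fg.
Qed.

Lemma eq_dsum_in {R : realType} (f g : plane R -> R) (D : diagram R) :
  (forall r, r \in enum_mset D -> f r = g r) -> dsum f D = dsum g D.
Proof.
by move=> fg; rewrite /dsum big_seq [RHS]big_seq; apply: eq_bigr => r; exact: fg.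
Qed.

Section EstimatorDeviation.
Context {R : realType} (L h LK : R) (K : plane R -> R) (n : nat)
  (d : measure_display) (T : measurableType d) (P : probability T R)
  (D : 'I_n -> T -> diagram R).
Hypotheses (h0 : 0 < h) (HK : kernel_conditions K LK) (n0 : (0 < n)%N).
Hypothesis DOmega : forall i t r, r \in enum_mset (D i t) -> Omega L r.
Hypothesis iid : iid_diagrams P D.

(* [wt] is the normalization of a diagram (1 or the inverse of its number of
   points) and [pp] the density of the mean measure so normalized. *)
Variables (wt : diagram R -> R) (pp : plane R -> R).
Hypothesis mwt : measurable_fun setT (wt : diagram_space R -> R).
Hypothesis wt0 : forall e, 0 <= wt e.
Hypothesis mpp : measurable_fun (Omega L) pp.
Hypothesis pp0 : forall w, Omega L w -> 0 <= pp w.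
Hypothesis meanA : forall i A, measurable A -> A `<=` Omega L ->
  (\int[P]_t (wt (D i t) * dsum \1_A (D i t))%:E = \int[leb2]_(w in A) (pp w)%:E)%E.

Let C : finType := ('I_(cells L h) * 'I_(cells L h))%type.
(* In the cell [c] the estimator is weighted by the constant [co c] and the
   diagrams are restricted to the window [A c]; the weighted mass [g] makes the
   windows of total mass at most 16, each point lying in at most 16 boxes. *)
Variables (A : C -> set (plane R)) (co : C -> R) (g : plane R -> R) (pb delta x0 : R).
Hypothesis mA : forall c, measurable (A c).
Hypothesis A_Omega : forall c, A c `<=` Omega L.
Hypothesis A_box : forall c, A c `<=` cell_box c.
Hypothesis co0 : forall c, 0 < co c.
Hypothesis g0 : forall x, 0 <= g x.
Hypothesis co_g : forall c x, A c x -> co c <= g x.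
Hypothesis g_pp : forall x, Omega L x -> g x * pp x <= pb.
Hypothesis pb0 : 0 <= pb.
Hypothesis g_mass : forall i, {ae P, forall t, wt (D i t) * dsum g (D i t) <= 1}.
Hypotheses (delta0 : 0 < delta) (x00 : 0 < x0) (x0x : x0 <= ln ((delta * h ^+ 2)^-1)).

(** The common form of [phat], where [wt] is 1, and [pcheck], where [wt] is the inverse size. *)
Definition window_estimator (w : plane R) (t : T) : R :=
  n%:R^-1 * \sum_(i < n) wt (D i t) *
    dsum (fun x => \1_(Omega L) x * scaled_kernel K h (psub x w)) (D i t).

Let X (c : C) (e : diagram_space R) : R := co c * (wt e * dsum \1_(A c) e).
Let Y (c : C) (u v : R) (e : diagram_space R) : R := co c * (wt e *
  dsum (fun x => \1_(A c) x * scaled_kernel K h (psub x (cell_point c u v))) e).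
(** Large enough for both the size and the Lipschitz bound of the kernel; the [+ 1] makes it
    positive. *)
Let B : R := supnorm setT K + `|LK| + 1.
(** 16 bounds the total mean mass of the windows, and [9 * pb] comes from the area [9 * h ^+ 2] of a
    box. *)
Let rho : R := 16 + 9 * pb.
Let N : R := n%:R * h ^+ 2.
Let x : R := ln ((delta * h ^+ 2)^-1).

Let h20 : 0 < h ^+ 2. Proof. by rewrite exprn_gt0. Qed.
Let Koo0 : 0 <= supnorm setT K.
Proof.
have := scaled_kernel_bounded HK h0 (0, 0) => /(le_trans (normr_ge0 _)).
by rewrite pmulr_lge0 ?invr_gt0.
Qed.
Let B0 : 0 < B. Proof. by rewrite /B; have := Koo0; have := normr_ge0 LK; lra. Qed.

Let mX c : measurable_fun setT (X c).
Proof.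
do 2 (apply: measurable_funM => //); apply: measurable_dsum.
exact: measurable_indic.
Qed.

Let indic_A0 c y : 0 <= \1_(A c) y :> R. Proof. by rewrite indicE. Qed.

Let X0 c e : 0 <= X c e.
Proof.
by rewrite /X mulr_ge0 ?(ltW (co0 c))// mulr_ge0// dsum_ge0.
Qed.

Let mY c u v : measurable_fun setT (Y c u v).
Proof.
do 2 (apply: measurable_funM => //); apply: measurable_dsum.
apply: measurable_funM; first exact: measurable_indic.
exact: measurable_scaled_kernel HK h0 _.
Qed.

Let window_le c (f : plane R -> R) (k : R) e : (forall y, `|f y| <= k) ->
  `|co c * (wt e * dsum (fun y => \1_(A c) y * f y) e)| <= k * X c e.
Proof.
move=> fk; rewrite !normrM (gtr0_norm (co0 c)) (ger0_norm (wt0 e)) /X.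
have -> : k * (co c * (wt e * dsum \1_(A c) e)) =
    co c * (wt e * dsum (fun y => k * \1_(A c) y) e) by rewrite dsumZ; ring.
rewrite ler_wpM2l ?(ltW (co0 c))// ler_wpM2l//; apply: norm_dsum_le => y.
by rewrite normrM (ger0_norm (indic_A0 c y)) mulrC ler_wpM2r.
Qed.

Let Y_bounded c u v e : `|Y c u v e| <= 2 * (B / h ^+ 2) * X c e.
Proof.
apply: window_le => y; apply: le_trans (scaled_kernel_bounded HK h0 _) _.
rewrite mulrA ler_wpM2r ?invr_ge0 ?(ltW h20)//.
by rewrite /B; have := normr_ge0 LK; have := Koo0; lra.
Qed.

Let Y_lipschitz c u v u' v' e :
  `|Y c u v e - Y c u' v' e| <= B / h ^+ 2 * (`|u - u'| + `|v - v'|) * X c e.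
Proof.
rewrite /Y -!mulrBr -dsumB.
under [X in `|_ * (_ * X)|]eq_bigr do rewrite -mulrBr.
apply: window_le => y; apply: le_trans (scaled_kernel_lipschitz HK h0 _ _) _.
rewrite /psub /cell_point/=.
(* Local coordinates are in units of [h], which cancels the extra [h^-1] in the Lipschitz constant
   of the scaled kernel. *)
have e1 (a b s s' : R) : a - (b + s) * h - (a - (b + s') * h) = (s' - s) * h by ring.
rewrite !e1 !normrM (gtr0_norm h0) -mulrDl mulfK ?gt_eqF//.
rewrite (distrC u') (distrC v') ler_wpM2r ?addr_ge0//.
rewrite ler_wpM2r ?invr_ge0 ?(ltW h20)// /B; have := Koo0; lra.
Qed.

Let pb_box c : (\int[leb2]_(w in A c) (co c * pp w)%:E <= (pb * (9 * h ^+ 2))%:E)%E.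
Proof.
have mppA : measurable_fun (A c) pp by apply: measurable_funS mpp => //; exact: measurable_Omega.
apply: (@le_trans _ _ (\int[leb2]_(w in A c) pb%:E)%E).
  apply: ge0_le_integral => //.
  - by move=> w Aw; rewrite lee_fin mulr_ge0 ?(ltW (co0 c))// pp0//; exact: A_Omega Aw.
  - by apply/measurable_EFinP; apply: measurable_funM.
  - move=> w Aw; rewrite lee_fin; have Ow := A_Omega Aw.
    by apply: le_trans (g_pp Ow); rewrite ler_wpM2r ?pp0// co_g.
rewrite integral_cst// EFinM lee_wpmul2l ?lee_fin// -(leb2_cell_box h0 c).
apply: le_measure; last exact: A_box.
  by apply/mem_set; exact: (mA c).
apply/mem_set; exact: (measurable_cell_box c).
Qed.

Let EX c i : (\int[P]_t (X c (D i t))%:E = \int[leb2]_(w in A c) (co c * pp w)%:E)%E.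
Proof.
have mppA : measurable_fun (A c) pp by apply: measurable_funS mpp => //; exact: measurable_Omega.
have mDi : measurable_fun setT (D i : T -> diagram_space R).
  by move=> _ S mS; rewrite setTI; apply: iid_measurable iid _ _ _.
under eq_integral do rewrite EFinM.
rewrite ge0_integralZl//; last 3 first.
- apply/measurable_EFinP; apply: (@measurableT_comp _ _ _ _ _ _
    (fun e : diagram_space R => wt e * dsum \1_(A c) e)) => //.
  by apply: measurable_funM => //; apply: measurable_dsum; exact: measurable_indic.
- by move=> t _; rewrite lee_fin mulr_ge0// dsum_ge0.
- by rewrite lee_fin ltW.
rewrite meanA// -ge0_integralZl//.
- exact/measurable_EFinP.
- by move=> w Aw; rewrite lee_fin pp0//; exact: A_Omega Aw.
- by rewrite lee_fin ltW.
Qed.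

Let m c : R := fine (\int[leb2]_(w in A c) (co c * pp w)%:E)%E.

Let mE c : (\int[leb2]_(w in A c) (co c * pp w)%:E = (m c)%:E)%E.
Proof.
rewrite fineK// ge0_fin_numE; first by apply: le_lt_trans (pb_box c) _; rewrite ltry.
by apply: integral_ge0 => w Aw; rewrite lee_fin mulr_ge0 ?(ltW (co0 c))// pp0//; exact: A_Omega Aw.
Qed.

Let Xm c i : (\int[P]_t (X c (D i t))%:E = (m c)%:E)%E.
Proof. by rewrite EX mE. Qed.

Let X_le_g c i t : X c (D i t) <= wt (D i t) * dsum g (D i t).
Proof.
rewrite /X mulrCA ler_wpM2l// -dsumZ; apply: ler_dsum_in => r _.
rewrite indicE; case: (boolP (r \in A c)) => [/set_mem Ar|_]; last by rewrite mulr0.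
by rewrite mulr1 co_g.
Qed.

(** Exchanging the sums over cells and over points, each point [r] is counted in at most 16 windows,
    each time with weight [co c <= g r]. *)
Let sum_X_le i t : \sum_c X c (D i t) <= 16 * (wt (D i t) * dsum g (D i t)).
Proof.
rewrite /X; under eq_bigr do rewrite mulrCA -dsumZ.
rewrite -mulr_sumr mulrCA ler_wpM2l// -dsumZ.
rewrite /dsum exchange_big/= -/(dsum _ _) -/(dsum _ _).
apply: ler_dsum_in => r /DOmega[r1 r12 _].
have := @sum_cell_box_le R L h h0 r (ltW r1) (ltW (lt_trans r1 r12)).
move=> /(ler_wpM2r (g0 r)); apply: le_trans; rewrite mulr_suml; apply: ler_sum => c _.
rewrite !indicE; case: (boolP (r \in A c)) => [/set_mem Ar|_].
  by rewrite mem_set ?mulr1 ?mul1r ?co_g//; exact: A_box Ar.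
by rewrite mulr0 mulr_ge0.
Qed.

Let mD i : measurable_fun setT (D i : T -> diagram_space R).
Proof. by move=> _ S mS; rewrite setTI; apply: iid_measurable iid _ _ _. Qed.

Let sum_m_le : \sum_c m c <= rho.
Proof.
have i0 : 'I_n by exact: Ordinal n0.
apply: (@le_trans _ _ 16); last by rewrite /rho lerDl mulr_ge0.
rewrite -lee_fin -sumEFin; under eq_bigr do rewrite -(Xm _ i0).
have mXi c : measurable_fun setT (fun t => X c (D i0 t)) by exact: (measurableT_comp (mX c) (mD i0)).
rewrite -ge0_integral_sum//; last 2 first.
- by move=> c; apply/measurable_EFinP.
- by move=> c t _; rewrite lee_fin.
rewrite -(integral_prob_cst P 16); apply: ae_ge0_le_integral => //.
- by move=> t _; rewrite sume_ge0// => c _; rewrite lee_fin.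
- by apply: emeasurable_sum => c; apply/measurable_EFinP.
apply: filterS (g_mass i0) => t gt _; rewrite sumEFin lee_fin.
by apply: le_trans (sum_X_le i0 t) _; rewrite -[leRHS]mulr1 ler_wpM2l.
Qed.

Let X1 c i : {ae P, forall t, X c (D i t) <= 1}.
Proof. by apply: filterS (g_mass i) => t; apply: le_trans; exact: X_le_g. Qed.

Let m_le c : m c <= rho * h ^+ 2.
Proof.
rewrite -lee_fin -mE; apply: le_trans (pb_box c) _; rewrite lee_fin /rho.
by rewrite mulrA [pb * 9]mulrC ler_wpM2r ?(ltW h20)// lerDr.
Qed.

(** When the window [A c] contains all points of [Omega L] within [h] of [w], restricting to it
    loses nothing, so the estimator at [w] is [(co c)^-1] times the average of [Y c u v], to which
    [uniform_deviation] applies. *)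
Lemma window_estimator_deviation : exists S : set T, [/\ measurable S,
  ((1 - delta)%:E <= P S)%E &
  forall t, S t -> forall c (u v : R), 0 <= u < 1 -> 0 <= v < 1 ->
    (forall y, Omega L y -> enorm (psub y (cell_point c u v)) <= h -> A c y) ->
    (`|(window_estimator (cell_point c u v) t)%:E -
       'E_P[window_estimator (cell_point c u v)]| <=
    ((co c)^-1 * (8 * B * (1 + 2 * rho) * (1 + 7 / x0) *
       Num.max (x / N) (Num.sqrt (x / N))))%:E)%E].
Proof.
have ind (S : 'I_n -> set (diagram_space R)) : (forall i, measurable (S i)) ->
    P (\bigcap_(i in [set: 'I_n]) (D i @^-1` S i)) = (\prod_(i < n) P (D i @^-1` S i))%E.
  by move=> mS; exact: iid_independent iid _ mS.
have b0 : 0 < B / h ^+ 2 by rewrite divr_gt0.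
have rho0 : 0 < rho by rewrite /rho ltr_pwDl// mulr_ge0.
have [S [mS PS HS]] := uniform_deviation mD ind n0 mX X0 Xm X1 mY Y_bounded Y_lipschitz
  b0 h20 rho0 delta0 m_le sum_m_le x00 x0x.
exists S; split => // t St c u v /andP[u0 u1] /andP[v0 v1] Anb.
set w := cell_point c u v.
have winY i t' : wt (D i t') * dsum (fun y => \1_(Omega L) y * scaled_kernel K h (psub y w))
    (D i t') = (co c)^-1 * Y c u v (D i t').
  rewrite /Y mulKf ?gt_eqF//; congr (_ * _); apply: eq_dsum_in => r /DOmega rO.
  rewrite !indicE mem_set// mul1r; case: (boolP (r \in A c)) => [_|/negP rA]; first by rewrite mul1r.
  rewrite mul0r (scaled_kernel_support HK)// ltNge; apply/negP => rh; apply: rA.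
  by apply/mem_set; exact: Anb.
have estE t' : window_estimator w t' = ((co c)^-1 / n%:R) * \sum_(i < n) Y c u v (D i t').
  rewrite /window_estimator; under eq_bigr do rewrite winY.
  by rewrite -mulr_sumr mulrA [_ * (co c)^-1]mulrC.
have IY i : P.-integrable setT (fun t' => (Y c u v (D i t'))%:E).
  exact: (integrable_dominated mD (mX c) (X0 c) (Xm c) i (mY c u v) (Y_bounded c u v)).
have EE : ('E_P[window_estimator w] =
    (((co c)^-1 / n%:R) * \sum_(i < n) mean P (D : 'I_n -> T -> diagram_space R) i (Y c u v))%:E)%E.
  rewrite unlock; under eq_integral do rewrite estE EFinM -sumEFin.
  rewrite integralZl//; last by apply: integrable_sum.
  rewrite integral_sum// [RHS]EFinM -sumEFin; congr (_ * _)%E; apply: eq_bigr => i _.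
  exact: (meanE mD (mX c) (X0 c) (Xm c) i (mY c u v) (Y_bounded c u v)).
rewrite EE estE -EFinB abse_EFin lee_fin -mulrBr -sumrB.
rewrite -[_ / _ * _]mulrA normrM gtr0_norm ?invr_gt0// ler_pM2l ?invr_gt0//.
apply: le_trans (HS t St c u v u0 u1 v0 v1) _.
by rewrite divfK ?gt_eqF.
Qed.

End EstimatorDeviation.

(** * The two estimators *)

Section Specializations.
Context {R : realType}.
Implicit Types (L h q M delta : R) (K : plane R -> R).

Lemma supnorm_kernel_ge0 K LK : kernel_conditions K LK -> 0 <= supnorm setT K.
Proof.
move=> HK; apply: (@le_trans _ _ `|K (0, 0)|) => //.
by apply: ub_le_sup; [exact: kernel_bounded HK|exists (0, 0)].
Qed.

Lemma deviation_boundE (C : R) (n : nat) h delta : 0 <= C ->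
  deviation_bound C C n h delta =
  C * Num.max (ln ((delta * h ^+ 2)^-1) / (n%:R * h ^+ 2))
              (Num.sqrt (ln ((delta * h ^+ 2)^-1) / (n%:R * h ^+ 2))).
Proof.
move=> C0; rewrite /deviation_bound maxr_pMr//; congr Num.max.
  by rewrite -mulrA; congr (_ * _); rewrite mulrC.
rewrite -mulrA; congr (_ * _); rewrite [X in _ = Num.sqrt X]mulrC sqrtrM//.
by rewrite invr_ge0 mulr_ge0// sqr_ge0.
Qed.

Lemma ln_threshold (r0 a : R) : 0 < a -> a <= r0 -> ln r0^-1 <= ln a^-1.
Proof.
move=> a0 ar; have r00 : 0 < r0 := lt_le_trans a0 ar.
by rewrite ler_ln ?posrE ?invr_gt0// lef_pV2 ?posrE.
Qed.

(** The constant of [window_estimator_deviation] with [rho] expanded. *)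
Definition rate_constant (B pb x0 : R) : R :=
  8 * B * (1 + 2 * (16 + 9 * pb)) * (1 + 7 / x0).

Lemma rate_constant_gt0 (B pb x0 : R) : 0 < B -> 0 <= pb -> 0 < x0 ->
  0 < rate_constant B pb x0.
Proof.
by move=> B0 pb0 x00; rewrite !mulr_gt0// ?ltr_pwDl// ?divr_ge0 ?(ltW x00)// mulr_ge0// addr_ge0// mulr_ge0.
Qed.

Context (d : measure_display) (T : measurableType d) (P : probability T R).

Lemma phat_window L K LK h n (D : 'I_n -> T -> diagram R) w t :
  kernel_conditions K LK -> 0 < h ->
  phat L K h (D^~ t) w = window_estimator L h K D (fun=> 1) w t.
Proof.
move=> HK h0; rewrite /phat /estimator /window_estimator; congr (_ * _).
apply: eq_bigr => i _; rewrite mul1r.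
by rewrite Rintegral_pmeasure//; [exact: measurable_Omega|exact: measurable_scaled_kernel HK h0 w].
Qed.

Lemma pcheck_window L K LK h n (D : 'I_n -> T -> diagram R) w t :
  kernel_conditions K LK -> 0 < h ->
  pcheck L K h (D^~ t) w =
  window_estimator L h K D (fun e => (size (enum_mset e))%:R^-1) w t.
Proof.
move=> HK h0; rewrite /pcheck /estimator /window_estimator; congr (_ * _).
apply: eq_bigr => i _.
by rewrite Rintegral_npmeasure//; [exact: measurable_Omega|exact: measurable_scaled_kernel HK h0 w].
Qed.

Lemma measurable_dist_bd L : 0 < L -> measurable_fun setT (@dist_bd R L).
Proof.
move=> L0; apply: (@measurable_lipschitz _ _ 1) => // x y; rewrite mul1r.
have h1 := dist_bd_lipschitz x y L0; have h2 := dist_bd_lipschitz y x L0.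
rewrite psubC_enorm in h2; have := enorm_le_l1 (psub x y); rewrite /psub/= => h3.
by rewrite ler_norml; apply/andP; split; lra.
Qed.

Lemma cell_point_near L h (c : 'I_(cells L h) * 'I_(cells L h)) (u v : R) : 0 < h ->
  0 <= u < 1 -> 0 <= v < 1 ->
  enorm (psub (cell_point c u v) (cell_point c 0 0)) <= 2 * h.
Proof.
move=> h0 /andP[u0 u1] /andP[v0 v1]; apply: le_trans (enorm_le_l1 _) _.
rewrite /psub /cell_point/=.
have e (b s : R) : (b + s) * h - (b + 0) * h = s * h by ring.
rewrite !e !normrM (gtr0_norm h0) (ger0_norm u0) (ger0_norm v0) -mulrDl.
by rewrite ler_wpM2r ?ltW//; lra.
Qed.

(** Normalized diagrams have mass at most 1, so the weights [g] and [co] are constantly 1 and the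
    windows are the boxes cut by [Omega L]. *)
Lemma pcheck_deviation L K LK h n (D : 'I_n -> T -> diagram R) p pt delta x0 ptoo :
  0 < L -> kernel_conditions K LK -> 0 < h -> persistence_sample P L D p pt ->
  bounded_on (Omega L) pt -> supnorm (Omega L) pt = ptoo ->
  0 < delta -> 0 < x0 -> x0 <= ln ((delta * h ^+ 2)^-1) ->
  probability_ge P (1 - delta)
    [set t | (ereal_sup
      [set `|(pcheck L K h (D^~ t) w)%:E - 'E_P[fun u => pcheck L K h (D^~ u) w]|
      | w in Omega L]
      <= (deviation_bound (rate_constant (supnorm setT K + `|LK| + 1) `|ptoo| x0)
            (rate_constant (supnorm setT K + `|LK| + 1) `|ptoo| x0) n h delta)%:E)%E].
Proof.
move=> L0 HK h0 [n0 DO iid _ den] pt_bd pt_sup delta0 x00 x0x.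
have Koo0 := supnorm_kernel_ge0 HK.
pose A (c : 'I_(cells L h) * 'I_(cells L h)) := Omega L `&` cell_box c.
have mA c : measurable (A c).
  by apply: measurableI; [exact: measurable_Omega|exact: (measurable_cell_box c)].
have ptb x : Omega L x -> 1 * pt x <= `|ptoo|.
  move=> Ox; rewrite mul1r; apply: le_trans (ler_norm _) _; apply: le_trans (ler_norm _).
  by rewrite -pt_sup; apply: ub_le_sup => //; exists x.
pose i0 := Ordinal n0.
have inv0 (e : diagram R) : 0 <= (size (enum_mset e))%:R^-1 :> R by [].
have mass i : {ae P, forall t, (size (enum_mset (D i t)))%:R^-1 * dsum (fun=> 1) (D i t) <= 1 :> R}.
  apply: aeW => t; rewrite dsum_size.
  (* An empty diagram has mass 0, as the inverse of 0 is 0. *)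
  have [->|s0] := eqVneq (size (enum_mset (D i t))) 0%N; first by rewrite mulr0.
  by rewrite mulVf// pnatr_eq0.
have meanA i B : measurable B -> B `<=` Omega L ->
    (\int[P]_t ((size (enum_mset (D i t)))%:R^-1 * dsum \1_B (D i t))%:E =
     \int[leb2]_(w in B) (pt w)%:E)%E.
  move=> mB BO; rewrite -(mean_densityE (den i))//.
  by apply: eq_integral => t _; rewrite npmeasureE.
have [S [mS PS HS]] := @window_estimator_deviation R L h LK K n d T P D h0 HK n0 DO iid
  (fun e => (size (enum_mset e))%:R^-1) pt measurable_size_inv inv0
  (mean_density_measurable (den i0)) (mean_density_ge0 (den i0)) meanA
  A (fun=> 1) (fun=> 1) `|ptoo| delta x0 mA (fun c x => @proj1 _ _) (fun c x => @proj2 _ _)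
  (fun=> ltr01) (fun=> ler01) (fun _ _ _ => lexx 1) ptb (normr_ge0 _) mass delta0 x00 x0x.
exists S; split => // t St /=.
apply: ge_ereal_sup => _ [w wO <-].
have [c [u [v [wE hu hv]]]] := Omega_in_cell h0 L0 wO.
have -> : (fun u => pcheck L K h (D^~ u) w) =
    window_estimator L h K D (fun e => (size (enum_mset e))%:R^-1) w.
  by apply/funext => s; exact: pcheck_window HK h0.
rewrite (pcheck_window _ _ _ _ HK h0) wE.
apply: le_trans (HS t St c u v hu hv _) _.
  by move=> y yO yw; split => //; exact: cell_box_nbhd hu hv yw.
rewrite deviation_boundE ?(ltW (rate_constant_gt0 _ _ _))//; last by have := normr_ge0 LK; lra.
by rewrite invr1 mul1r.
Qed.

Lemma phat_deviation L K LK h n (D : 'I_n -> T -> diagram R) p pt q M delta x0 pbaroo :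
  0 < q -> 0 < M ->
  0 < L -> kernel_conditions K LK -> 0 < h -> persistence_sample P L D p pt ->
  bounded_total_persistence P L q M D ->
  bounded_on (Omega L) (weighted L q p) -> supnorm (Omega L) (weighted L q p) = pbaroo ->
  0 < delta -> 0 < x0 -> x0 <= ln ((delta * h ^+ 2)^-1) ->
  let C := 5 `^ q * M * rate_constant (supnorm setT K + `|LK| + 1) (`|pbaroo| / M) x0 in
  probability_ge P (1 - delta)
    [set t | (ereal_sup
      [set ((dist_bd L w - h) `^ q)%:E *
           `|(phat L K h (D^~ t) w)%:E - 'E_P[fun u => phat L K h (D^~ u) w]|
      | w in Omega_from L (2 * h)]
      <= (deviation_bound C C n h delta)%:E)%E].
Proof.
move=> q0 M0 L0 HK h0 [n0 DO iid den _] btp p_bd p_sup delta0 x00 x0x C.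
have Koo0 := supnorm_kernel_ge0 HK.
(* [lc c] is comparable to [dist_bd L w - h] uniformly over the points [w] of
   the cell at distance at least [2 * h] from the diagonal. *)
pose lc (c : 'I_(cells L h) * 'I_(cells L h)) : R :=
  Num.max h (dist_bd L (cell_point c 0 0) - 3 * h).
have lch c : h <= lc c by rewrite le_max lexx.
have lc0 c : 0 < lc c := lt_le_trans h0 (lch c).
pose A (c : 'I_(cells L h) * 'I_(cells L h)) :=
  Omega L `&` cell_box c `&` [set x | lc c <= dist_bd L x].
have mdist := measurable_dist_bd L0.
have mA c : measurable (A c).
  apply: measurableI.
    by apply: measurableI; [exact: measurable_Omega|exact: (measurable_cell_box c)].
  rewrite -[X in measurable X]setTI.
  rewrite (_ : [set x | _] = @dist_bd R L @^-1` `[lc c, +oo[%classic).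
    by apply: mdist => //; exact: measurable_itv.
  by apply/seteqP; split => x; rewrite /= in_itv/= andbT.
pose g (x : plane R) := dist_bd L x `^ q / M.
have g0 x : 0 <= g x by rewrite divr_ge0 ?powR_ge0 ?ltW.
have gp x : Omega L x -> g x * p x <= `|pbaroo| / M.
  move=> Ox; rewrite /g mulrAC ler_wpM2r ?invr_ge0 ?(ltW M0)//.
  apply: le_trans (ler_norm _) _; apply: le_trans (ler_norm _).
  by rewrite -p_sup; apply: ub_le_sup => //; exists x.
pose i0 := Ordinal n0.
have mdq : measurable_fun setT (fun x => dist_bd L x `^ q).
  by apply: (measurableT_comp (measurable_powR q)).
have mass i : {ae P, forall t, 1 * dsum g (D i t) <= 1 :> R}.
  apply: filterS btp => t Ht; rewrite mul1r.
  have : (\int[pmeasure (D i t)]_(w in Omega L) (dist_bd L w `^ q)%:E < M%:E)%E.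
    by apply: le_lt_trans Ht; exact: le_bigmax.
  rewrite ge0_integral_pmeasure//; [|exact: measurable_Omega|by move=> x; exact: powR_ge0].
  rewrite lte_fin => /ltW HM.
  have -> : dsum g (D i t) = dsum (fun x => \1_(Omega L) x * dist_bd L x `^ q) (D i t) / M.
    rewrite mulrC -dsumZ; apply: eq_dsum_in => r /DO rO.
    by rewrite indicE mem_set// mul1r mulrC.
  by rewrite ler_pdivrMr// mul1r.
have meanA i B : measurable B -> B `<=` Omega L ->
    (\int[P]_t (1 * dsum \1_B (D i t))%:E = \int[leb2]_(w in B) (p w)%:E)%E.
  move=> mB BO; rewrite -(mean_densityE (den i))//.
  by apply: eq_integral => t _; rewrite mul1r pmeasureE.
have co0 c : 0 < lc c `^ q / M by rewrite divr_gt0// powR_gt0.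
have co_g c x : A c x -> lc c `^ q / M <= g x.
  move=> [_ /= lx]; rewrite /g ler_wpM2r ?invr_ge0 ?(ltW M0)//.
  by rewrite ge0_ler_powR ?(ltW q0)// ?nnegrE ?(ltW (lc0 c))// (le_trans _ lx)// ltW.
have pb0 : 0 <= `|pbaroo| / M by rewrite divr_ge0// ltW.
have [S [mS PS HS]] := @window_estimator_deviation R L h LK K n d T P D h0 HK n0 DO iid
  (fun=> 1) p (measurable_cst _) (fun=> ler01)
  (mean_density_measurable (den i0)) (mean_density_ge0 (den i0)) meanA
  A (fun c => lc c `^ q / M) g (`|pbaroo| / M) delta x0 mA
  (fun c x H => proj1 (proj1 H)) (fun c x H => proj2 (proj1 H))
  co0 g0 co_g gp pb0 mass delta0 x00 x0x.
exists S; split => // t St /=.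
apply: ge_ereal_sup => _ [w [wO w2h] <-].
have [c [u [v [wE hu hv]]]] := Omega_in_cell h0 L0 wO.
have -> : (fun u => phat L K h (D^~ u) w) = window_estimator L h K D (fun=> 1) w.
  by apply/funext => s; exact: phat_window HK h0.
rewrite (phat_window _ _ _ _ HK h0).
have near := cell_point_near c h0 hu hv.
have d1 := dist_bd_lipschitz w (cell_point c 0 0) L0.
have d2 := dist_bd_lipschitz (cell_point c 0 0) w L0.
rewrite -wE in near; rewrite [X in _ <= _ + X]psubC_enorm in d2.
(* Moving to the corner of the cell costs [2 * h], so the left side is at most [lc c + 4 * h], and
   [h <= lc c]. *)
have L2 : dist_bd L w - h <= 5 * lc c.
  have : dist_bd L (cell_point c 0 0) - 3 * h <= lc c by rewrite le_max lexx orbT.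
  by have := lch c; lra.
have bound : (`|(window_estimator L h K D (fun=> 1%R) w t)%:E -
      'E_P[window_estimator L h K D (fun=> 1%R) w]| <=
    ((lc c `^ q / M)^-1 *
      (rate_constant (supnorm setT K + `|LK| + 1) (`|pbaroo| / M) x0 *
       Num.max (ln ((delta * h ^+ 2)^-1) / (n%:R * h ^+ 2))
              (Num.sqrt (ln ((delta * h ^+ 2)^-1) / (n%:R * h ^+ 2)))))%:E)%E.
  rewrite wE; apply: HS => // y yO yw.
  split; first by split => //; exact: cell_box_nbhd hu hv yw.
  rewrite -wE in yw.
  (* The distance of [y] is at least that of [w] minus [h]: at least [h] because [w] lies in
     [Omega_from L (2 * h)], and at least that of the corner minus [3 * h]. *)
  have := dist_bd_lipschitz w y L0; rewrite psubC_enorm => d3.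
  by rewrite /= ge_max; apply/andP; split; lra.
have lq : (dist_bd L w - h) `^ q <= 5 `^ q * lc c `^ q.
  rewrite -powRM//; last exact: ltW.
  by rewrite ge0_ler_powR ?(ltW q0)// ?nnegrE ?mulr_ge0 ?(ltW (lc0 c))//; lra.
have Q0 : 0 < rate_constant (supnorm setT K + `|LK| + 1) (`|pbaroo| / M) x0.
  by rewrite rate_constant_gt0//; have := normr_ge0 LK; lra.
rewrite deviation_boundE; last first.
  by apply: (mulr_ge0 _ (ltW Q0)); rewrite mulr_ge0 ?powR_ge0 ?(ltW M0).
apply: le_trans (lee_wpmul2l _ bound) _; first by rewrite lee_fin powR_ge0.
rewrite -EFinM lee_fin /C; set Q := rate_constant _ _ _; set mx := Num.max _ _.
have QM0 : 0 <= (lc c `^ q / M)^-1 * (Q * mx).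
  rewrite mulr_ge0 ?invr_ge0 ?(ltW (co0 c))//; apply: (mulr_ge0 (ltW Q0)).
  by rewrite le_max sqrtr_ge0 orbT.
apply: le_trans (ler_wpM2r QM0 lq) _.
rewrite le_eqVlt; apply/orP; left; apply/eqP; field.
by rewrite !gt_eqF// powR_gt0.
Qed.

End Specializations.

Theorem theorem2p4 (R : realType) (q M Koo K2 LK r0 : R)
    (q_gt0 : 0 < q) (M_gt0 : 0 < M) (r0_gt0 : 0 < r0) (r0_lt1 : r0 < 1) :
  (forall pbaroo : R, exists C1 C2 : R, [/\ 0 < C1, 0 < C2 &
     forall (L : R) (K : plane R -> R) (h : R) (n : nat)
       (d : measure_display) (T : measurableType d) (P : probability T R)
       (D : 'I_n -> T -> diagram R) (p pt : plane R -> R),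
     0 < L ->
     kernel_conditions K LK -> supnorm setT K = Koo -> L2norm K = K2 ->
     0 < h ->
     persistence_sample P L D p pt ->
     bounded_total_persistence P L q M D ->
     bounded_on (Omega L) (weighted L q p) -> bounded_on (Omega L) pt ->
     supnorm (Omega L) (weighted L q p) = pbaroo ->
     forall delta : R, 0 < delta -> delta < 1 -> delta * h ^+ 2 <= r0 ->
     probability_ge P (1 - delta)
       [set t | (ereal_sup
          [set ((dist_bd L w - h) `^ q)%:E *
               `|(phat L K h (D^~ t) w)%:E
                 - 'E_P[fun u => phat L K h (D^~ u) w]|
          | w in Omega_from L (2 * h)]
          <= (deviation_bound C1 C2 n h delta)%:E)%E]])
  /\
  (forall ptoo : R, exists C1 C2 : R, [/\ 0 < C1, 0 < C2 &
     forall (L : R) (K : plane R -> R) (h : R) (n : nat)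
       (d : measure_display) (T : measurableType d) (P : probability T R)
       (D : 'I_n -> T -> diagram R) (p pt : plane R -> R),
     0 < L ->
     kernel_conditions K LK -> supnorm setT K = Koo -> L2norm K = K2 ->
     0 < h ->
     persistence_sample P L D p pt ->
     bounded_total_persistence P L q M D ->
     bounded_on (Omega L) (weighted L q p) -> bounded_on (Omega L) pt ->
     supnorm (Omega L) pt = ptoo ->
     forall delta : R, 0 < delta -> delta < 1 -> delta * h ^+ 2 <= r0 ->
     probability_ge P (1 - delta)
       [set t | (ereal_sup
          [set `|(pcheck L K h (D^~ t) w)%:E
                 - 'E_P[fun u => pcheck L K h (D^~ u) w]|
          | w in Omega L]
          <= (deviation_bound C1 C2 n h delta)%:E)%E]]).
Proof.
(* From [delta * h ^+ 2 <= r0 < 1] the logarithm is at least [ln r0^-1 > 0], which serves as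
   [x0]. *)
have x00 : 0 < ln r0^-1 by rewrite ln_gt0// invf_gt1.
split=> [pbaroo|ptoo].
(* The constants are chosen before the kernel and the sample, for arbitrary reals [Koo], [LK] and
   [pbaroo]; the absolute values keep them positive. *)
- set C := 5 `^ q * M * rate_constant (`|Koo| + `|LK| + 1) (`|pbaroo| / M) (ln r0^-1).
  have C0 : 0 < C.
    have p5 : 0 < 5 `^ q * M by rewrite mulr_gt0 ?powR_gt0.
    by apply: (mulr_gt0 p5); rewrite rate_constant_gt0 ?divr_ge0 ?(ltW M_gt0).
  exists C, C; split => // L K h n d T P D p pt L0 HK Kinf _ h0 smp btp wbd _ wsup delta.
  move=> delta0 _ dh; rewrite /C -Kinf (ger0_norm (supnorm_kernel_ge0 HK)).
  apply: (phat_deviation q_gt0 M_gt0 L0 HK h0 smp btp wbd wsup delta0 x00).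
  exact: ln_threshold (mulr_gt0 delta0 (exprn_gt0 2 h0)) dh.
- set C := rate_constant (`|Koo| + `|LK| + 1) `|ptoo| (ln r0^-1).
  have C0 : 0 < C by rewrite rate_constant_gt0.
  exists C, C; split => // L K h n d T P D p pt L0 HK Kinf _ h0 smp _ _ pbd psup delta.
  move=> delta0 _ dh; rewrite /C -Kinf (ger0_norm (supnorm_kernel_ge0 HK)).
  apply: (pcheck_deviation L0 HK h0 smp pbd psup delta0 x00).
  exact: ln_threshold (mulr_gt0 delta0 (exprn_gt0 2 h0)) dh.
Qed.
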